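(* Let $Q$ be a finitely generated group. Then there is a short exact sequence of groups $$1\rightarrow N\rightarrow G\rightarrow Q\rightarrow 1$$ such that (i) $G$ is a left-orderable finitely generated small cancellation group, and (ii) the kernel $N$ is finitely generated. Moreover, if $Q$ is finitely presented, then $G$ can be chosen finitely presented.
   Context: A group is left-orderable if it admits a total order that is invariant under left-multiplication. Small cancellation words: let $F(\mathcal A)$ be the free group on an alphabet $\mathcal A$, with word length $|\cdot|$, and let $(g,h)=\frac12(|g|+|h|-|g^{-1}h|)$ be the Gromov product (the length of the longest common prefix of the reduced words $g,h$). Reduced and cyclically reduced words $w_1,w_2,\ldots$ (finitely or infinitely many) are small cancellation words if $|w_i|>6$ for all $i$ and $(v_1,v_2)<\frac16\min\{|v_1|,|v_2|\}$ for all distinct words $v_1,v_2$ that are reduced and cyclically reduced cyclic conjugates of the words $w_i$ or their inverses. A small cancellation group is a group given by a presentation $\langle \mathcal A\mid w_1,w_2,\ldots\rangle$ whose relators are small cancellation words (i.e. the presentation satisfies the classical $C'(1/6)$-condition). *)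

(* Defs.v *)
From HB Require Import structures.
From mathcomp Require Import all_boot all_order all_algebra.
From mathcomp Require Import boolp classical_sets functions cardinality.

Set Implicit Arguments.
Unset Strict Implicit.
Unset Printing Implicit Defensive.

Local Open Scope classical_set_scope.

Section GroupNotions.
Variable G : groupType.

Definition is_subgroup (H : set G) :=
  H 1%g /\ forall x y, H x -> H y -> H (x / y)%g.

Definition is_normal_subgroup (H : set G) :=
  is_subgroup H /\ forall x g, H x -> H (x ^ g)%g.

Definition generated (S : set G) : set G := smallest is_subgroup S.

Definition normal_closure (S : set G) : set G := smallest is_normal_subgroup S.

Definition finitely_generated :=
  exists S : set G, finite_set S /\ generated S = setT.

Definition left_orderable :=
  exists le : rel G,
    [/\ reflexive le, antisymmetric le, transitive le, total le
      & forall g x y, le x y -> le (g * x)%g (g * y)%g].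

End GroupNotions.

(* A {multiplicative _ -> _} between groups is a group homomorphism
   (preservation of 1 and of inverses follows). *)
Definition short_exact (N G Q : groupType)
    (i : {multiplicative N -> G}) (p : {multiplicative G -> Q}) :=
  [/\ injective i, range i = p @^-1` [set 1%g] & range p = setT].

(* The free group F(A): the letter (a, false) stands for a, (a, true) for
   a^-1, and the elements are the reduced words. *)
Section FreeGroup.
Variable A : choiceType.
Implicit Types (x y : A * bool) (w s : seq (A * bool)).

Definition letter_inv x : A * bool := (x.1, ~~ x.2).

Definition no_cancel x y := y != letter_inv x.

Definition reduced w := sorted no_cancel w.

Record freegroup := FreeGroup { word :> seq (A * bool); _ : reduced word }.

HB.instance Definition _ := [isSub for word].
HB.instance Definition _ := [Choice of freegroup by <:].

Lemma letter_invK : involutive letter_inv.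
Proof. by case=> a b; rewrite /letter_inv /= negbK. Qed.

Definition push x w :=
  if w is y :: w' then if y == letter_inv x then w' else x :: w else [:: x].

Lemma reduced_push x w : reduced w -> reduced (push x w).
Proof.
case: w => //= y w rw; case: ifPn => [_|yx]; first exact: path_sorted rw.
by rewrite /reduced /= /no_cancel yx.
Qed.

Lemma pushK x w : reduced w -> push (letter_inv x) (push x w) = w.
Proof.
case: w => [|y w] /=; first by rewrite letter_invK eqxx.
case: eqP => [->|_ _]; last by rewrite /= letter_invK eqxx.
by case: w => //= z w /andP[]; rewrite /no_cancel => /negPf ->.
Qed.

Lemma pushVK x w : reduced w -> push x (push (letter_inv x) w) = w.
Proof. by move=> /(pushK (letter_inv x)); rewrite letter_invK. Qed.

Definition mul_word w s := foldr push s w.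

Lemma reduced_mul w s : reduced s -> reduced (mul_word w s).
Proof. by move=> rs; elim: w => //= x w; exact: reduced_push. Qed.

Lemma mul_push x w s : reduced s -> mul_word (push x w) s = push x (mul_word w s).
Proof.
move=> rs; case: w => //= y w; case: eqP => //= ->.
by rewrite pushVK ?reduced_mul.
Qed.

Lemma mul_wordA w1 w2 w3 : reduced w3 ->
  mul_word w1 (mul_word w2 w3) = mul_word (mul_word w1 w2) w3.
Proof. by move=> r3; elim: w1 => //= x w ->; rewrite mul_push. Qed.

Lemma mul_word0 w : reduced w -> mul_word w [::] = w.
Proof.
elim: w => //= x w IHw rxw; rewrite IHw; last exact: path_sorted rxw.
by case: w rxw {IHw} => //= y w /andP[/negPf ->].
Qed.

Definition inv_word w := rev (map letter_inv w).

Lemma reduced_inv w : reduced w -> reduced (inv_word w).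
Proof.
rewrite /reduced /inv_word rev_sorted sorted_map.
by apply: sub_sorted => x y /=; rewrite /no_cancel letter_invK eq_sym.
Qed.

Lemma mulV_word w s : reduced s -> mul_word (inv_word w) (mul_word w s) = s.
Proof.
move=> rs; elim: w => //= x w IHw.
rewrite /inv_word /= rev_cons /mul_word foldr_rcons pushK //.
exact: reduced_mul.
Qed.

Lemma inv_wordK : involutive inv_word.
Proof.
by move=> w; rewrite /inv_word map_rev revK (mapK letter_invK).
Qed.

Definition fg_one : freegroup := @FreeGroup [::] isT.
Definition fg_mul (g h : freegroup) : freegroup :=
  FreeGroup (reduced_mul g (valP h)).
Definition fg_inv (g : freegroup) : freegroup :=
  FreeGroup (reduced_inv (valP g)).

Lemma fg_mulA : associative fg_mul.
Proof. by move=> g h k; apply/val_inj; exact: mul_wordA (valP k). Qed.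

Lemma fg_mul1 : left_id fg_one fg_mul.
Proof. by move=> g; exact/val_inj. Qed.

Lemma fg_mulr1 : right_id fg_one fg_mul.
Proof. by move=> g; apply/val_inj; exact: mul_word0 (valP g). Qed.

Lemma fg_mulV : left_inverse fg_one fg_inv fg_mul.
Proof.
move=> g; apply/val_inj => /=.
by rewrite -[X in mul_word _ X](mul_word0 (valP g)) mulV_word.
Qed.

Lemma fg_mulrV : right_inverse fg_one fg_inv fg_mul.
Proof.
move=> g; rewrite -[X in fg_mul X _](_ : fg_inv (fg_inv g) = _) ?fg_mulV //.
exact/val_inj/inv_wordK.
Qed.

HB.instance Definition _ :=
  isGroup.Build freegroup fg_mulA fg_mul1 fg_mulr1 fg_mulV fg_mulrV.

Definition wlen (g : freegroup) : nat := size (word g).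

Definition gromov_product (g h : freegroup) : rat :=
  (((wlen g)%:R + (wlen h)%:R - (wlen (g^-1 * h)%g)%:R) / 2)%R.

(* cycle also compares the last letter with the first one. *)
Definition cyclically_reduced (g : freegroup) := cycle no_cancel (word g).

Definition cyclic_conjugate (v w : freegroup) :=
  exists k, word v = rot k (word w).

Definition symmetrized (R : set freegroup) : set freegroup :=
  [set v | cyclically_reduced v /\
     exists2 w : freegroup, R w & cyclic_conjugate v w \/ cyclic_conjugate v (w^-1)%g].

Definition small_cancellation_words (R : set freegroup) :=
  [/\ countable R,
      (forall w : freegroup, R w -> cyclically_reduced w /\ (6 < wlen w)%N)
    & forall v1 v2, symmetrized R v1 -> symmetrized R v2 -> v1 <> v2 ->
        (gromov_product v1 v2 < 6^-1 * (minn (wlen v1) (wlen v2))%:R)%R].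

(* G is given by the presentation <A | R>, i.e. G is isomorphic to the
   quotient of F(A) by the normal closure of R. *)
Definition presented_by (R : set freegroup) (G : groupType) :=
  exists f : {multiplicative freegroup -> G},
    range f = setT /\ f @^-1` [set 1%g] = normal_closure R.

End FreeGroup.

Definition small_cancellation_group (G : groupType) :=
  exists (A : choiceType) (R : set (freegroup A)),
    small_cancellation_words R /\ presented_by R G.

Definition finitely_presented (G : groupType) :=
  exists (A : finType) (R : set (freegroup A)),
    finite_set R /\ presented_by R G.

(* Main.v *)
(* Let X generate Q.  The group G has the generators X, two stable letters a, c,
   a letter x and letters y_0, .., y_29; its relators are u P_n Y_n, where u runs
   over the commutators [q^e, z] (q in X, z a generator not in X) and over the
   relators of Q, n = n(u) >= |u| is injective in u,
     P_n = (c^-1 a^n) x (c^-1 a^n)^-1 (c a^n) x (c a^n)^-1,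
     Y_n = y_0^E y_1^E .. y_29^E,  E = 10 (n + 1).
   As in Rips' construction, the generators outside X generate the kernel N of
   G -> Q.  A sixth of a relator contains some y_m y_(m+1)^E y_(m+2), which
   determines n and the position: this gives small cancellation.

   For the order, let L be the free group on a and c, and map G onto L by killing
   the other generators.  The kernel is generated by the letters z_l = l z l^-1
   (l in L), subject to the translates by l of the relators.  Such a translate
   contains x_(l c a^n) and x_(l c^-1 a^n) once each, and at least one of the two
   indices is reduced as written; it can be solved for the corresponding x.  The
   index, which ends with c^(+-1) a^n, determines n and l, and all other letters x
   of the relator have indices of smaller weight, so all relators can be solved
   simultaneously and the kernel is free.  So G is free-by-free, hence
   left-orderable. *)
From HB Require Import structures.
Require Import Defs.
From mathcomp Require Import all_boot all_order all_algebra.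
From mathcomp Require Import boolp classical_sets functions cardinality.
From mathcomp Require Import zify lra.

Set Implicit Arguments.
Unset Strict Implicit.
Unset Printing Implicit Defensive.

Local Open Scope classical_set_scope.
Local Open Scope group_scope.
Local Open Scope quotient_scope.

(** * Homomorphisms, subgroups, quotients and positive cones *)

Section Homomorphisms.
Variables (G H : groupType) (f : {multiplicative G -> H}).

Lemma mult1 : f 1 = 1.
Proof. by apply: (@mulgI _ (f 1)); rewrite -gmulfM !mulg1. Qed.

Lemma multV x : f x^-1 = (f x)^-1.
Proof. by apply: (@mulgI _ (f x)); rewrite -gmulfM !mulgV mult1. Qed.

Lemma multF x y : f (x / y) = f x / f y.
Proof. by rewrite gmulfM multV. Qed.

Lemma multJ x y : f (x ^ y) = f x ^ f y.
Proof. by rewrite !conjgE !gmulfM multV. Qed.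

Lemma subgroup_preimage (S : set H) : is_subgroup S -> is_subgroup (f @^-1` S).
Proof.
move=> [S1 SF]; split; first by rewrite /preimage /= mult1.
by move=> x y Sx Sy; rewrite /preimage /= multF; exact: SF.
Qed.

Lemma subgroup_image (S : set G) : is_subgroup S -> is_subgroup (f @` S).
Proof.
move=> [S1 SF]; split; first by exists 1; rewrite ?mult1.
by move=> _ _ [x Sx <-] [y Sy <-]; exists (x / y); [exact: SF|exact: multF].
Qed.

Lemma normal_kernel : is_normal_subgroup (f @^-1` [set 1]).
Proof.
split; first by apply: subgroup_preimage; split => //= x y -> ->; rewrite divgg.
by move=> x g; rewrite /preimage /= multJ => ->; rewrite conj1g.
Qed.

End Homomorphisms.

Section Subgroups.
Variable G : groupType.
Implicit Types S H : set G.

Lemma subgroupV H x : is_subgroup H -> H x -> H x^-1.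
Proof. by move=> [H1 HF] Hx; rewrite -(mul1g x^-1); exact: HF. Qed.

Lemma subgroupM H x y : is_subgroup H -> H x -> H y -> H (x * y).
Proof.
by move=> sH Hx Hy; rewrite -(invgK y); apply: sH.2 => //; exact: subgroupV.
Qed.

Lemma generated_subgroup S : is_subgroup (generated S).
Proof.
split=> [A [[A1 _] _] //|x y Sx Sy A [sA SA]].
by apply: sA.2; [exact: Sx | exact: Sy].
Qed.

Lemma normal_closure_normal S : is_normal_subgroup (normal_closure S).
Proof.
split; [split=> [A [[[A1 _] _] _] //|x y Sx Sy A [sA SA]]|].
  by apply: sA.1.2; [exact: Sx | exact: Sy].
by move=> x g Sx A [sA SA]; apply: sA.2; exact: Sx.
Qed.

Definition positive_cone (P : set G) :=
  [/\ forall x y, P x -> P y -> P (x * y), ~ P 1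
    & forall x, x <> 1 -> P x \/ P x^-1].

(** Left multiplication does not change x^-1 y, so membership of x^-1 y in [P] defines an invariant
    order. *)
Lemma left_orderable_cone P : positive_cone P -> left_orderable G.
Proof.
move=> [PM P1 PV]; exists (fun x y => `[< x = y \/ P (x^-1 * y) >]); split.
- by move=> x; apply/asboolP; left.
- move=> x y /andP[/asboolP[//|Pxy] /asboolP[//|Pyx]].
  by case: P1; have := PM _ _ Pxy Pyx; rewrite mulgA mulgK mulVg.
- move=> y x z /asboolP[->//|Pxy] /asboolP[<-|Pyz]; apply/asboolP; right => //.
  by have := PM _ _ Pxy Pyz; rewrite mulgA mulgK.
- move=> x y; case: (pselect (x = y)) => [->|xy].
    by apply/orP; left; apply/asboolP; left.
  have [/eqP|Pxy|Pxy] := PV (x^-1 * y).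
  + by rewrite mulg_eq1 => /eqP/invg_inj.
  + by apply/orP; left; apply/asboolP; right.
  + by apply/orP; right; apply/asboolP; right; rewrite invgM invgK in Pxy.
- move=> g x y /asboolP[->|Pxy]; apply/asboolP; [by left | right].
  by rewrite invgM -mulgA mulKg.
Qed.

End Subgroups.

Section Quotients.
Variables (G : groupType) (K : set G).
Hypothesis nK : is_normal_subgroup K.

Definition same_coset (x y : G) : bool := `[< K (x^-1 * y) >].

Lemma same_coset_refl : reflexive same_coset.
Proof. by move=> x; apply/asboolP; rewrite mulVg; case: nK => -[]. Qed.

Lemma same_coset_sym : symmetric same_coset.
Proof.
by move=> x y; apply/asboolP/asboolP => /(subgroupV nK.1); rewrite invgM invgK.
Qed.

Lemma same_coset_trans : transitive same_coset.
Proof.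
move=> y x z /asboolP Kxy /asboolP Kyz; apply/asboolP.
by have := subgroupM nK.1 Kxy Kyz; rewrite mulgA mulgK.
Qed.

Canonical same_coset_equiv :=
  EquivRel same_coset same_coset_refl same_coset_sym same_coset_trans.

Definition quotient_type := {eq_quot same_coset_equiv}.

HB.instance Definition _ := Choice.on quotient_type.
HB.instance Definition _ := EqQuotient.on quotient_type.

Lemma pi_quotient x y :
  (\pi_quotient_type x = \pi_quotient_type y) <-> K (x^-1 * y).
Proof.
split; first by move/eqmodP => /asboolP.
by move=> Kxy; apply/eqmodP/asboolP.
Qed.

Lemma repr_quotient x : K (x^-1 * repr (\pi_quotient_type x)).
Proof. by apply/pi_quotient; rewrite reprK. Qed.

Definition quotient_mul (u v : quotient_type) : quotient_type :=
  \pi_quotient_type (repr u * repr v).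
Definition quotient_inv (u : quotient_type) : quotient_type :=
  \pi_quotient_type (repr u)^-1.
Definition quotient_one : quotient_type := \pi_quotient_type 1.

Lemma pi_quotient_mul x y :
  quotient_mul (\pi_quotient_type x) (\pi_quotient_type y) =
    \pi_quotient_type (x * y).
Proof.
apply/esym/pi_quotient.
have Kx := repr_quotient x; have Ky := repr_quotient y.
set x' := repr _ in Kx *; set y' := repr _ in Ky *.
rewrite (_ : _ * _ = (x^-1 * x') ^ y * (y^-1 * y')).
  by apply: subgroupM => //; [exact: nK.1 | exact: nK.2].
by rewrite conjgE invgM !mulgA mulgK.
Qed.

Lemma pi_quotient_inv x :
  quotient_inv (\pi_quotient_type x) = \pi_quotient_type x^-1.
Proof.
apply/pi_quotient; have Kx := repr_quotient x; set x' := repr _ in Kx *.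
rewrite invgK (_ : _ * _ = ((x^-1 * x') ^ (x^-1))).
  by apply: nK.2.
by rewrite conjgE invgK !mulgA mulgV mul1g.
Qed.

Lemma pi_quotient_surj (u : quotient_type) : exists x, \pi_quotient_type x = u.
Proof. by exists (repr u); rewrite reprK. Qed.

Lemma quotient_mulA : associative quotient_mul.
Proof.
move=> u v w; have [x <-] := pi_quotient_surj u.
have [y <-] := pi_quotient_surj v; have [z <-] := pi_quotient_surj w.
by rewrite !pi_quotient_mul mulgA.
Qed.

Lemma quotient_mul1 : left_id quotient_one quotient_mul.
Proof.
by move=> u; have [x <-] := pi_quotient_surj u; rewrite pi_quotient_mul mul1g.
Qed.

Lemma quotient_mulr1 : right_id quotient_one quotient_mul.
Proof.
by move=> u; have [x <-] := pi_quotient_surj u; rewrite pi_quotient_mul mulg1.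
Qed.

Lemma quotient_mulV : left_inverse quotient_one quotient_inv quotient_mul.
Proof.
move=> u; have [x <-] := pi_quotient_surj u.
by rewrite pi_quotient_inv pi_quotient_mul mulVg.
Qed.

Lemma quotient_mulrV : right_inverse quotient_one quotient_inv quotient_mul.
Proof.
move=> u; have [x <-] := pi_quotient_surj u.
by rewrite pi_quotient_inv pi_quotient_mul mulgV.
Qed.

HB.instance Definition _ := isGroup.Build quotient_type
  quotient_mulA quotient_mul1 quotient_mulr1 quotient_mulV quotient_mulrV.

Definition quotient_map (x : G) : quotient_type := \pi_quotient_type x.

Lemma quotient_mapM : {morph quotient_map : x y / x * y}.
Proof. by move=> x y; rewrite /quotient_map [RHS]pi_quotient_mul. Qed.

HB.instance Definition _ :=
  isMultiplicative.Build G quotient_type quotient_map quotient_mapM.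

Lemma quotient_exists : exists (Gq : groupType) (f : {multiplicative G -> Gq}),
  range f = setT /\ f @^-1` [set 1] = K.
Proof.
exists quotient_type, quotient_map; split.
  by apply/seteqP; split=> // u _; exists (repr u); rewrite //= /quotient_map reprK.
apply/seteqP; split=> x; rewrite /preimage /=.
  by move/esym/pi_quotient; rewrite invg1 mul1g.
by move=> Kx; apply/esym/pi_quotient; rewrite invg1 mul1g.
Qed.

End Quotients.

Section SubgroupType.
Variables (G : groupType) (H : set G).
Hypothesis sH : is_subgroup H.

Definition subgroup_pred : {pred G} := fun x => `[< H x >].

Record subgroup_type := SubgroupElt {
  subgroup_val :> G; _ : subgroup_val \in subgroup_pred }.

HB.instance Definition _ := [isSub for subgroup_val].
HB.instance Definition _ := [Choice of subgroup_type by <:].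

Lemma subgroup_group_closed : group_closed subgroup_pred.
Proof.
split; first by apply/asboolP; case: sH.
by move=> x y /asboolP Hx /asboolP Hy; apply/asboolP/sH.2.
Qed.

HB.instance Definition _ :=
  SubChoice_isSubGroup.Build G subgroup_pred subgroup_type subgroup_group_closed.

Lemma subgroup_exists : exists (N : groupType) (i : {multiplicative N -> G}),
  injective i /\ range i = H.
Proof.
exists subgroup_type, (val : subgroup_type -> G); split; first exact: val_inj.
apply/seteqP; split=> [_ [x _ <-]|x Hx]; first by have /asboolP := valP x.
by exists (SubgroupElt (introT (asboolP _) Hx : x \in subgroup_pred)).
Qed.

End SubgroupType.

Lemma factor_exists (F G Q : groupType) (f : {multiplicative F -> G})
    (h : {multiplicative F -> Q}) :
  range f = setT -> f @^-1` [set 1] `<=` h @^-1` [set 1] ->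
  exists p : {multiplicative G -> Q}, forall x, p (f x) = h x.
Proof.
move=> fsurj kerf.
have fex (g : G) : exists x, f x = g.
  by have : range f g by [rewrite fsurj]; case=> x _ <-; exists x.
(* The value of [p] is read off a chosen preimage under [f]; the inclusion of kernels makes it
   independent of the choice. *)
have /choice[sec secK] := fex.
have fh x y : f x = f y -> h x = h y.
  move=> fxy; apply/divg1_eq; rewrite -multF; apply: kerf.
  by rewrite /preimage /= multF fxy divgg.
pose p g := h (sec g).
have pM : {morph p : x y / x * y}.
  by move=> x y; rewrite /p -gmulfM; apply: fh; rewrite gmulfM !secK.
pose p' := HB.pack_for (Multiplicative.type G Q) p
  (isMultiplicative.Build G Q p pM).
by exists p' => x; apply: fh; rewrite secK.
Qed.

(** * Words in free groups and the universal property *)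

Section FreeGroups.
Variable A : choiceType.
Implicit Types (x y : A * bool) (w s u v : seq (A * bool)).

Definition gen (a : A) : freegroup A := @FreeGroup A [:: (a, false)] isT.

Section Evaluation.
Variables (G : groupType) (f : A -> G).

Definition eval_letter x : G := if x.2 then (f x.1)^-1 else f x.1.
Definition eval_word w : G := foldr (fun x g => eval_letter x * g) 1 w.
Definition fg_lift (g : freegroup A) : G := eval_word (word g).

Lemma eval_letter_inv x : eval_letter (letter_inv x) = (eval_letter x)^-1.
Proof. by case: x => a [] //=; rewrite /eval_letter /= invgK. Qed.

Lemma eval_word_cat w s : eval_word (w ++ s) = eval_word w * eval_word s.
Proof. by elim: w => [|x w IHw] /=; rewrite ?mul1g // IHw mulgA. Qed.

Lemma eval_word_push x w : eval_word (push x w) = eval_letter x * eval_word w.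
Proof.
case: w => //= y w; case: eqP => //= ->.
by rewrite eval_letter_inv mulgA mulgV mul1g.
Qed.

Lemma eval_word_mul w s : eval_word (mul_word w s) = eval_word w * eval_word s.
Proof.
by elim: w => [|x w IHw] /=; rewrite ?mul1g // eval_word_push IHw mulgA.
Qed.

Lemma fg_liftM : {morph fg_lift : g h / g * h}.
Proof. by move=> g h; exact: eval_word_mul. Qed.

HB.instance Definition _ := isMultiplicative.Build (freegroup A) G fg_lift fg_liftM.

Lemma fg_lift_gen a : fg_lift (gen a) = f a.
Proof. exact: mulg1. Qed.

End Evaluation.

Lemma reduced_mul_nil w : reduced (mul_word w [::]).
Proof. exact: reduced_mul. Qed.

(** The element represented by a word that may fail to be reduced. *)
Definition of_word w : freegroup A := FreeGroup (reduced_mul_nil w).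

Lemma of_word_cat w s : of_word (w ++ s) = of_word w * of_word s.
Proof.
apply/val_inj; rewrite /= -mul_wordA ?reduced_mul_nil //.
by rewrite /mul_word foldr_cat.
Qed.

Lemma of_wordK (g : freegroup A) : of_word (word g) = g.
Proof. by apply/val_inj; rewrite /= mul_word0 //; exact: (valP g). Qed.

Lemma word_of_word w : reduced w -> word (of_word w) = w.
Proof. exact: mul_word0. Qed.

Lemma fg_lift_of_word (G : groupType) (f : A -> G) w :
  fg_lift f (of_word w) = eval_word f w.
Proof. by rewrite /fg_lift /= eval_word_mul mulg1. Qed.

Lemma hom_eval (G : groupType) (f : {multiplicative freegroup A -> G}) g :
  f g = eval_word (f \o gen) (word g).
Proof.
rewrite -{1}[g]of_wordK; elim: (word g) => [|x w IHw] /=.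
  by rewrite -(mult1 f); congr (f _); exact/val_inj.
rewrite -cat1s of_word_cat gmulfM IHw; congr (_ * _).
case: x => a []; rewrite /eval_letter /= -?multV; congr (f _); exact/val_inj.
Qed.

Lemma hom_ext (G : groupType) (f h : {multiplicative freegroup A -> G}) :
  (forall a, f (gen a) = h (gen a)) -> f =1 h.
Proof.
move=> fh g; rewrite !hom_eval; elim: (word g) => //= x w ->; congr (_ * _).
by rewrite /eval_letter /= fh.
Qed.

Lemma subgroup_free (S : set (freegroup A)) :
  is_subgroup S -> (forall a, S (gen a)) -> S = setT.
Proof.
move=> sS Sgen; apply/seteqP; split=> // g _.
rewrite -[g]of_wordK; elim: (word g) => [|x w IHw].
  by rewrite (_ : of_word _ = 1); [case: sS | exact/val_inj].
rewrite -cat1s of_word_cat; apply: subgroupM => //.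
case: x => a [].
  by rewrite (_ : of_word _ = (gen a)^-1); [exact: subgroupV | exact/val_inj].
by rewrite (_ : of_word _ = gen a) //; exact/val_inj.
Qed.

(* The Gromov product (g^-1, h) is the length of the cancelled part c. *)
Lemma mul_cancellation (g h : freegroup A) : exists u c v,
  [/\ word g = u ++ c, word h = inv_word c ++ v & word (g * h) = u ++ v].
Proof.
case: g h => w rw [s rs]; rewrite /mul /=.
elim: w rw => [|x w IHw] rw /=; first by exists [::], [::], s.
have [u [c [v [ew -> ->]]]] := IHw (path_sorted rw).
rewrite {}ew in rw *.
case: u rw => [|y u] rw.
  case: v => [|y v] /=; first by exists [:: x], c, [::].
  case: eqP => [->|_]; last by exists [:: x], c, (y :: v).
  exists [::], (x :: c), v; split=> //.
  by rewrite /inv_word /= rev_cons cat_rcons.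
exists (x :: y :: u), c, v; split=> //=; case: eqP => // yx.
by move: rw; rewrite /reduced /= /no_cancel yx eqxx.
Qed.

End FreeGroups.

Arguments gen {A}.

(** * Left-orderability of free groups *)

(* The order of Dicks and Sunic: g is positive when the signed count of edges
   and turns along the path from 1 to g in the Cayley tree is positive; a turn
   compares, for an invariant linear order, the two half-edges at a vertex. *)
Section FreeGroupOrder.
Variable A : countType.
Implicit Types (x y : A * bool) (w s u v : seq (A * bool)).

Definition turn x y : int := if (pickle x < pickle y)%N then 1%Z else (-1)%Z.
Definition edge_sign x : int := if x.2 then (-1)%Z else 1%Z.

Definition head_turn (ox oy : option (A * bool)) : int :=
  if ox is Some x then if oy is Some y then turn x y else 0%Z else 0%Z.

Fixpoint tau w : int :=
  if w is x :: w' then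
    (edge_sign x + head_turn (Some (letter_inv x)) (ohead w') + tau w')%R
  else 0%Z.

(** The half-edge at the end of the path [w] that leads back along its last edge. *)
Definition last_inv w : option (A * bool) := ohead (inv_word w).

Lemma last_inv_rcons w x : last_inv (rcons w x) = Some (letter_inv x).
Proof. by rewrite /last_inv /inv_word map_rcons rev_rcons. Qed.

Lemma tau_cat w s :
  tau (w ++ s) = (tau w + head_turn (last_inv w) (ohead s) + tau s)%R.
Proof.
elim: w => [|x w IHw]; first by rewrite /=; lia.
rewrite /= {}IHw; case/lastP: w => [|w z] //=.
  by rewrite /last_inv /inv_word /=; lia.
have -> : last_inv (x :: rcons w z) = Some (letter_inv z).
  by rewrite -rcons_cons last_inv_rcons.
rewrite last_inv_rcons.
have -> : ohead (rcons w z ++ s) = ohead (rcons w z) by case: w.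
lia.
Qed.

Lemma turnC x y : x <> y -> turn y x = (- turn x y)%R.
Proof.
rewrite /turn => xy; have : pickle x <> pickle y by move/(pcan_inj pickleK).
by do 2?case: ifP; lia.
Qed.

Lemma inv_word_cons x w : inv_word (x :: w) = rcons (inv_word w) (letter_inv x).
Proof. by rewrite /inv_word /= rev_cons. Qed.

Lemma inv_word_cat w s : inv_word (w ++ s) = inv_word s ++ inv_word w.
Proof. by rewrite /inv_word map_cat rev_cat. Qed.

(** Reversing a path changes the sign of each edge and swaps the two half-edges of each turn; these
    differ because the word is reduced. *)
Lemma tau_inv w : reduced w -> tau (inv_word w) = (- tau w)%R.
Proof.
elim: w => [|x w IHw] // rxw; rewrite inv_word_cons -cats1 tau_cat.
rewrite {}IHw /=; last exact: path_sorted rxw.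
rewrite /last_inv inv_wordK; case: w rxw => [|y w] /=.
  by case: x => a [].
rewrite /reduced /= => /andP[/eqP xy _]; rewrite (turnC (nesym xy)).
by rewrite /edge_sign; case: x {xy} => a [] /=; lia.
Qed.

(** Parity: m letters give m edges and m - 1 turns, hence an odd number of terms 1 or -1. *)
Lemma tau_neq0 w : w <> [::] -> tau w <> 0%R.
Proof.
suff H x s : exists k : int, tau (x :: s) = (2 * k + 1)%R.
  by case: w => // x w _; have [k ->] := H x w; lia.
elim: s x => [|y s IHs] x.
  by case: x => a []; rewrite /edge_sign /=; [exists (-1)%R | exists 0%R].
have [k] := IHs y; rewrite [tau (x :: _)]/= -/(tau (y :: s)) => ->.
have [e ->] : exists e : int, edge_sign x = (2 * e + 1)%R.
  by case: x => a []; rewrite /edge_sign /=; [exists (-1)%R | exists 0%R].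
have [e' ->] : exists e : int, turn (letter_inv x) y = (2 * e + 1)%R.
  by rewrite /turn; case: ifP; [exists 0%R | exists (-1)%R].
by exists (e + e' + k + 1)%R; lia.
Qed.

(* Three turns around a vertex cannot all go the same way. *)
Lemma head_turn_triple (p q r : option (A * bool)) :
  (-1 <= head_turn p r - head_turn p q - head_turn q r <= 1)%R.
Proof.
by case: p q r => [x|] [y|] [z|] //=; rewrite /turn; (do ?case: ifP => ?); lia.
Qed.

(** The cancelled part contributes opposite amounts to [g] and [h]; only the three turns at the
    branching vertex remain to be compared. *)
Lemma tau_mul (g h : freegroup A) :
  (tau (word g) + tau (word h) - 1 <= tau (word (g * h)%g))%R.
Proof.
have [u [c [v [eg eh egh]]]] := mul_cancellation g h.
have rg : reduced (u ++ c) by rewrite -eg; exact: valP.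
rewrite eg eh egh !tau_cat tau_inv; last by case/cat_sorted2: rg.
have -> : last_inv (inv_word c) = ohead c by rewrite /last_inv inv_wordK.
have /andP[] := head_turn_triple (last_inv u) (ohead c) (ohead v).
by move: (head_turn _ _) (head_turn _ _) (head_turn _ _) => *; lia.
Qed.

Lemma freegroup_cone : exists P : set (freegroup A), positive_cone P.
Proof.
exists [set g | (0 < tau (word g))%R]; split=> [g h|//|g g1].
  (* Two integers that are at least 1 keep a positive sum after a loss of at most 1. *)
  by have := tau_mul g h; move=> /=; lia.
rewrite /= tau_inv; last exact: valP.
have : tau (word g) <> 0%R by apply: tau_neq0 => g0; apply: g1; exact/val_inj.
lia.
Qed.

End FreeGroupOrder.

HB.instance Definition _ (A : countType) := [Countable of freegroup A by <:].

(** * Left-orders from crossed homomorphisms *)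

(* The word w, read along its path in L starting at l, is evaluated in H with
   weight psi z p on the edge z starting at p: these are the coordinates of the
   homomorphism from F(A) to the unrestricted wreath product of H by L. *)
Section CrossedEvaluation.
Variables (A : choiceType) (L H : groupType) (s : A -> L).
Implicit Types (x : A * bool) (w v : seq (A * bool)) (g h : freegroup A).

Section Eval.
Variable psi : A -> L -> H.

(** Reading an inverse letter at [l] runs backwards along an edge that starts at [l / s x.1]. *)
Definition cross_letter x (l : L) : H :=
  if x.2 then (psi x.1 (l / s x.1))^-1 else psi x.1 l.

Fixpoint cross w (l : L) : H :=
  if w is x :: w' then cross_letter x l * cross w' (l * eval_letter s x) else 1.

Lemma cross_cat w v l : cross (w ++ v) l = cross w l * cross v (l * eval_word s w).
Proof.
elim: w l => [|x w IHw] l /=; first by rewrite mul1g mulg1.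
by rewrite IHw !mulgA.
Qed.

Lemma cross_push x w l : cross (push x w) l = cross (x :: w) l.
Proof.
case: w => // y w /=; case: eqP => // ->; rewrite mulgA.
case: x => z [] /=; rewrite /cross_letter /eval_letter /=.
  by rewrite mulVg mul1g mulgVK.
by rewrite mulgK mulgV mul1g.
Qed.

Lemma cross_mul_word w v l :
  cross (mul_word w v) l = cross w l * cross v (l * eval_word s w).
Proof.
rewrite -cross_cat; elim: w l => //= x w IHw l.
by rewrite cross_push /= IHw.
Qed.

Lemma cross_mul g h l : cross (word (g * h)) l = cross g l * cross h (l * fg_lift s g).
Proof. exact: cross_mul_word. Qed.

Lemma cross_inv g l : cross g l * cross (word g^-1) (l * fg_lift s g) = 1.
Proof. by rewrite -cross_mul mulgV. Qed.

Lemma cross_of_word w l : cross (word (of_word w)) l = cross w l.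
Proof. by rewrite /= cross_mul_word /= mulg1. Qed.

(** The kernel of the homomorphism to the wreath product, in coordinates. *)
Definition cross_kernel : set (freegroup A) :=
  [set g | fg_lift s g = 1 /\ forall l, cross g l = 1].

Lemma cross_kernel_normal : is_normal_subgroup cross_kernel.
Proof.
have inv g l : fg_lift s g = 1 -> cross (word g^-1) l = (cross g l)^-1.
  by move=> sg; have := cross_inv g l; rewrite sg mulg1 => /mulg1_eq.
split; [split=> [|g h [sg eg] [sh eh]]|move=> g h [sg eg]].
- by split=> //; exact: mult1.
- split=> [|l]; first by rewrite multF /= sg sh divgg.
  by rewrite cross_mul eg sg inv // eh invg1 mulg1.
split=> [|l]; first by rewrite multJ /= sg conj1g.
rewrite conjgE !cross_mul eg mul1g sg mulg1.
by rewrite -cross_mul mulVg.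
Qed.

End Eval.

(** The product telescopes along the path: the values of [sigma] at intermediate vertices cancel. *)
Lemma hom_cross (G : groupType) (f : {multiplicative freegroup A -> G})
    (sigma : {multiplicative L -> G}) (chi : {multiplicative H -> G}) psi :
  (forall z l, chi (psi z l) = sigma l * f (gen z) / sigma (l * s z)) ->
  forall w l, chi (cross psi w l) =
    sigma l * eval_word (f \o gen) w / sigma (l * eval_word s w).
Proof.
move=> chiE; elim=> [|x w IHw] l /=; first by rewrite mult1 !mulg1 divgg.
rewrite gmulfM {}IHw !mulgA; congr (_ * _ / _).
case: x => z []; rewrite /cross_letter /eval_letter /=.
  by rewrite multV chiE mulgVK !invgM !invgK !mulgA mulgVK.
by rewrite chiE mulgVK.
Qed.

(** The order is lexicographic: the image in [L] decides first, then the coordinate at 1 in [H]. The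
    kernel inclusion keeps 1 out of the cone. If both data are trivial, [chi] shows that the element
    of [G] is trivial. *)
Lemma cross_left_orderable (G : groupType)
    (f : {multiplicative freegroup A -> G})
    (sigma : {multiplicative L -> G}) (chi : {multiplicative H -> G}) psi
    (PL : set L) (PH : set H) :
  range f = setT -> f @^-1` [set 1] `<=` cross_kernel psi ->
  (forall z l, chi (psi z l) = sigma l * f (gen z) / sigma (l * s z)) ->
  positive_cone PL -> positive_cone PH -> left_orderable G.
Proof.
move=> fsurj kerf chiE [PLM PL1 PLV] [PHM PH1 PHV].
pose P g := PL (fg_lift s g) \/ fg_lift s g = 1 /\ PH (cross psi (word g) 1).
apply: (@left_orderable_cone _ (f @` P)); split.
- move=> _ _ [g Pg <-] [h Ph <-]; exists (g * h); rewrite ?gmulfM //.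
  rewrite /P gmulfM /= -/(word (g * h)) cross_mul mul1g; case: Pg => [Lg|[-> Hg]].
    by left; case: Ph => [Lh|[-> _]]; rewrite ?mulg1 //; exact: PLM.
  rewrite mul1g; case: Ph => [Lh|[-> Hh]]; [by left | right].
  by split=> //; exact: PHM.
- by case=> g Pg /kerf[sg eg]; case: Pg; rewrite sg ?eg // => -[].
move=> u u1; have : range f u by rewrite fsurj.
case=> g _ fg; rewrite -{}fg in u1 *.
case: (pselect (fg_lift s g = 1)) => sg; last first.
  have [Pg|Pg] := PLV _ sg; [left | right; rewrite -multV].
    by exists g => //; left.
  by exists g^-1 => //; left; rewrite multV.
have /PHV[Pg|Pg] : cross psi g 1 <> 1.
- move=> eg; apply: u1; have := hom_cross chiE g 1.
  rewrite eg -/(fg_lift s g) sg mulg1 !mult1 mul1g divg1 hom_eval; exact: esym.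
- by left; exists g => //; right.
- right; rewrite -multV; exists g^-1 => //; right; rewrite multV /= sg invg1.
  split=> //; have := cross_inv psi g 1.
  by rewrite sg mulg1 => /mulg1_eq <-.
Qed.

End CrossedEvaluation.

(** * The relators and the left-order *)

(* Left summand: the generators of Q.  Right summand: two stable letters
   (true = a, false = c), the letter x (None) and the letters y_0, .., y_29. *)
Definition alphabet (X : finType) : finType := (X + (bool + option 'I_30))%type.

Section Relators.
Variable X : finType.
Let T := alphabet X.
Let L := freegroup bool.
Implicit Types (w v : seq (bool * bool)) (l : L) (z : T) (n e k : nat).

Definition sletter (b : bool) : T := inr (inl b).
Definition xletter : T := inr (inr None).
Definition yletter (i : 'I_30) : T := inr (inr (Some i)).

Definition stable_word w : seq (T * bool) := [seq (sletter x.1, x.2) | x <- w].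

Definition conj_word w :=
  stable_word w ++ (xletter, false) :: stable_word (inv_word w).

(* the words c a^n (b = false) and c^-1 a^n (b = true) *)
Definition code_word n (b : bool) := (false, b) :: nseq n (true, false).

Definition elim_word n :=
  conj_word (code_word n true) ++ conj_word (code_word n false).

(** Position k lies in run [k %/ e], which is below 30, so [inord] never takes its default value. *)
Definition run_word e : seq (T * bool) :=
  mkseq (fun k => (yletter (inord (k %/ e)), false)) (30 * e).
Definition relator (u : seq (T * bool)) n :=
  u ++ elim_word n ++ run_word (10 * n.+1).

Definition stable_part (z : T) : L :=
  if z is inr (inl b) then gen b else 1.

Lemma eval_nonstable (u : seq (T * bool)) :
  all (fun x => if x.1 is inr (inl _) then false else true) u ->
  eval_word stable_part u = 1.
Proof.
elim: u => //= -[[q|[b|o]] e] u IHu //= /IHu ->; case: e => //=;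
by rewrite /eval_letter /= ?invg1 mulg1.
Qed.

Lemma eval_stable_word w : eval_word stable_part (stable_word w) = of_word w.
Proof.
elim: w => [|[b e] w IHw] /=; first exact/val_inj.
rewrite IHw -cat1s of_word_cat; congr (_ * _).
by case: e; rewrite /eval_letter /=; exact/val_inj.
Qed.

Lemma of_word_inv w : of_word (inv_word w) = (of_word w)^-1.
Proof.
apply/esym/mulg1_eq; rewrite -of_word_cat; apply/val_inj => /=.
by rewrite /mul_word foldr_cat -/(mul_word _ _) -{1}(inv_wordK w) mulV_word.
Qed.

Lemma eval_conj_word w : eval_word stable_part (conj_word w) = 1.
Proof.
rewrite eval_word_cat /= !eval_stable_word of_word_inv.
by rewrite /eval_letter /= mul1g mulgV.
Qed.

Lemma eval_elim_word n : eval_word stable_part (elim_word n) = 1.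
Proof.
by rewrite /elim_word [LHS]eval_word_cat !eval_conj_word mulg1.
Qed.

Lemma eval_run_word e : eval_word stable_part (run_word e) = 1.
Proof. by apply: eval_nonstable; apply/allP=> x /mapP[k _ ->]. Qed.

Lemma eval_relator u n :
  eval_word stable_part (relator u n) = eval_word stable_part u.
Proof.
rewrite /relator [LHS]eval_word_cat [X in _ * X]eval_word_cat.
by rewrite eval_elim_word eval_run_word !mulg1.
Qed.

Section Cross.
Variables (H : groupType) (psi : T -> L -> H).
Hypothesis psi_stable : forall b l, psi (sletter b) l = 1.

Lemma cross_stable_word w l : cross stable_part psi (stable_word w) l = 1.
Proof.
elim: w l => // -[b e] w IHw l /=; rewrite IHw mulg1 /cross_letter /=.
by case: e; rewrite psi_stable ?invg1.
Qed.

(** Stable letters have weight 1, so only the middle x counts, read at the point that [w] leads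
    to. *)
Lemma cross_conj_word w l :
  cross stable_part psi (conj_word w) l = psi xletter (l * of_word w).
Proof.
rewrite cross_cat /= !cross_stable_word eval_stable_word mul1g mulg1.
by [].
Qed.

Lemma cross_elim_word n l :
  cross stable_part psi (elim_word n) l =
    psi xletter (l * of_word (code_word n true))
    * psi xletter (l * of_word (code_word n false)).
Proof.
by rewrite /elim_word [LHS]cross_cat eval_conj_word mulg1 !cross_conj_word.
Qed.

Lemma cross_relator u n l : eval_word stable_part u = 1 ->
  cross stable_part psi (relator u n) l =
    cross stable_part psi u l * psi xletter (l * of_word (code_word n true))
    * psi xletter (l * of_word (code_word n false))
    * cross stable_part psi (run_word (10 * n.+1)) l.
Proof.
move=> u1; rewrite /relator [LHS]cross_cat [X in _ * X]cross_cat u1 mulg1.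
by rewrite eval_elim_word mulg1 cross_elim_word !mulgA.
Qed.

End Cross.

(* Every letter x of u is read at the starting point l. *)
Definition xlocal (u : seq (T * bool)) := forall (H : groupType)
    (psi psi' : T -> L -> H) l,
  (forall z, z != xletter -> psi z =1 psi' z) ->
  psi xletter l = psi' xletter l ->
  cross stable_part psi u l = cross stable_part psi' u l.

Lemma xlocal_run_word e : xlocal (run_word e).
Proof.
move=> H psi psi' l E _; rewrite /run_word /mkseq.
elim: (iota _ _) l => //= k s IHs l.
by rewrite IHs /cross_letter /= E.
Qed.

(* c weighs more than c^-1: of two reduced indices l c a^n and l c^-1 a^n, the
   former is eliminated in terms of the latter. *)
Definition weight w : nat := \sum_(x <- w) (1 + (x == (false, false))).

Lemma weight_cat w v : weight (w ++ v) = weight w + weight v.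
Proof. exact: big_cat. Qed.

Lemma weight_nil : weight [::] = 0.
Proof. exact: big_nil. Qed.

Lemma weight_cons x w : weight (x :: w) = 1 + (x == (false, false)) + weight w.
Proof. exact: big_cons. Qed.

Lemma weight_mul_word w v : (weight (mul_word w v) <= weight w + weight v)%N.
Proof.
elim: w => [|x w IHw] /=; first exact: leq_addl.
rewrite weight_cons.
case E: (mul_word w v) IHw => [|y s] /=; first by rewrite weight_cons; lia.
by case: ifP => _; rewrite !weight_cons; lia.
Qed.

Lemma weight_mul (l l' : L) :
  (weight (word (l * l')%g) <= weight (word l) + weight (word l'))%N.
Proof. exact: weight_mul_word. Qed.

Lemma weight_nseq n : weight (nseq n (true, false)) = n.
Proof. by elim: n => [|n IHn] /=; rewrite ?weight_cons ?IHn ?weight_nil. Qed.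

Lemma weight_code_word n b : weight (code_word n b) = (n + 2 - b)%N.
Proof. by rewrite weight_cons weight_nseq; case: b => /=; lia. Qed.

(* The relator of index n at l is solved for the letter x at [top n l], the
   one of l c a^n, l c^-1 a^n that is reduced as written. *)
Definition cinv_last l : bool := last (true, false) l == (false, true).
Definition top n l : L := l * of_word (code_word n (cinv_last l)).
Definition low n l : L := l * of_word (code_word n (~~ cinv_last l)).

Lemma reduced_code_word n b : reduced (code_word n b).
Proof. by rewrite /reduced /=; elim: n => [|[|n] IHn] //=; move: IHn; case: b. Qed.

(** After a final c^-1 the code begins with c^-1; in all other cases it begins with c, which nothing
    but c^-1 could cancel. *)
Lemma reduced_top n l : reduced (l ++ code_word n (cinv_last l)).
Proof.
have rl : reduced l := valP l; have := reduced_code_word n (cinv_last l).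
rewrite /cinv_last; case: (word l) rl => [|y w] //; rewrite /reduced /= => rw rc.
rewrite cat_path rw /= rc andbT /no_cancel.
by case: (last y w) => [[] []].
Qed.

Lemma word_top n l : word (top n l) = l ++ code_word n (cinv_last l).
Proof.
by rewrite /top -{1}[l]of_wordK -of_word_cat word_of_word // reduced_top.
Qed.

(** Read from the right, the letters a before the first c^(+-1) count [n], and what lies beyond that
    letter is [l]. *)
Lemma top_inj n n' l l' : top n l = top n' l' -> n = n' /\ l = l'.
Proof.
move=> /(congr1 (@word _)); rewrite !word_top => /(congr1 rev).
rewrite !rev_cat /code_word !rev_cons !rev_nseq !cat_rcons => E.
suff [-> /(can_inj revK) E'] : n = n' /\ rev l = rev l' by split=> //; exact/val_inj.
elim: n n' E => [|n IHn] [|n'] //=.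
  by case=> _ ->.
by case=> /IHn[-> ->].
Qed.

Lemma weight_top n l : (weight l < weight (top n l))%N.
Proof. rewrite word_top weight_cat weight_code_word; case: cinv_last; lia. Qed.

(** If [l] ends with c^-1, the c of the lower index cancels it. Otherwise the lower index has c^-1
    in place of c, which weighs less. *)
Lemma weight_low n l : (weight (low n l) < weight (top n l))%N.
Proof.
rewrite word_top weight_cat weight_code_word.
case cl: (cinv_last l); last first.
  rewrite /low cl; apply: (leq_ltn_trans (weight_mul _ _)).
  rewrite word_of_word ?reduced_code_word //.
  by rewrite weight_code_word; lia.
have [w ew] : exists w, word l = rcons w (false, true).
  move: cl; rewrite /cinv_last; case/lastP: (word l) => // w x.
  by rewrite last_rcons => /eqP ->; exists w.
have -> : low n l = of_word (w ++ nseq n (true, false)).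
  rewrite /low cl -{1}[l]of_wordK ew -of_word_cat cat_rcons !of_word_cat.
  by congr (_ * _); apply/val_inj; rewrite /= (pushVK (false, true)) ?reduced_mul_nil.
have -> : weight l = (weight w + 1)%N.
  by rewrite ew -cats1 weight_cat weight_cons weight_nil.
rewrite of_word_cat; apply: (leq_ltn_trans (weight_mul _ _)).
rewrite (word_of_word (w := nseq _ _)); last first.
  by move: (reduced_code_word (n) true); exact: path_sorted.
have := weight_mul_word w [::]; rewrite weight_nseq weight_nil /=; lia.
Qed.

(** * Solving all relators of the kernel of G -> L simultaneously *)

Section LeftOrder.
Variables (J : Type) (J0 : set J) (n : J -> nat) (u : J -> seq (T * bool)).
Hypotheses (n_inj : injective n) (ulocal : forall j, xlocal (u j)).
Hypothesis ustable : forall j, eval_word stable_part (u j) = 1.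
Variables (G : groupType) (f : {multiplicative freegroup T -> G}).
Hypothesis fsurj : range f = setT.
Hypothesis kerf :
  f @^-1` [set 1] =
  normal_closure ((fun j => of_word (relator (u j) (n j))) @` J0).

(** For a letter z that is not stable, the generator [(z, l)] stands for l z l^-1. *)
Let H := freegroup (T * L)%type.

Definition elim_index l : option (J * L) :=
  if pselect (exists p : J * L, J0 p.1 /\ l = top (n p.1) p.2) is left ex
  then Some (projT1 (cid ex)) else None.

Lemma elim_index_top j l : J0 j -> elim_index (top (n j) l) = Some (j, l).
Proof.
move=> Jj; rewrite /elim_index; case: pselect => [ex|[]]; last by exists (j, l).
by case: cid => -[j' l'] /= [_ /top_inj[/n_inj <- <-]].
Qed.

Lemma elim_indexP l j l' :
  elim_index l = Some (j, l') -> J0 j /\ l = top (n j) l'.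
Proof.
rewrite /elim_index; case: pselect => // ex [E].
by case: cid E => p /= Hp E; rewrite E in Hp.
Qed.

Definition free_value z l : H := if z is inr (inl _) then 1 else gen (z, l).

(* The solution of [A * v * p * B = 1] (if b) or [A * p * v * B = 1] in v. *)
Definition solve b (A B p : H) : H :=
  if b then A^-1 * B^-1 * p^-1 else p^-1 * A^-1 * B^-1.

Lemma solveK b A B p :
  A * (if b then solve b A B p else p)
    * (if b then p else solve b A B p) * B = 1.
Proof.
case: b; rewrite /solve !mulgA; first by rewrite mulgV mul1g mulgVK mulVg.
by rewrite mulgK mulgV mul1g mulVg.
Qed.

(** The number [k] is fuel: each solution calls x only at indices of smaller weight, so the fuel
    [(weight l).+1] in [psi] suffices. *)
Fixpoint value k z l : H :=
  if k is k'.+1 then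
    if z == xletter then
      if elim_index l is Some (j, l') then
        solve (cinv_last l') (cross stable_part (value k') (u j) l')
          (cross stable_part (value k') (run_word (10 * (n j).+1)) l')
          (value k' xletter (low (n j) l'))
      else free_value z l
    else free_value z l
  else free_value z l.

Lemma valueS k z l : value k.+1 z l =
  if z == xletter then
    if elim_index l is Some (j, l') then
      solve (cinv_last l') (cross stable_part (value k) (u j) l')
        (cross stable_part (value k) (run_word (10 * (n j).+1)) l')
        (value k xletter (low (n j) l'))
    else free_value z l
  else free_value z l.
Proof. by []. Qed.

Definition psi z l : H := value (weight l).+1 z l.

Lemma value_nonx k z l : z != xletter -> value k z l = free_value z l.
Proof. by case: k => //= k /negPf ->. Qed.

(** At an index [top (n j) l'] the solution uses x only at [l'], by locality of the words, and at
    [low (n j) l']; both weigh less. *)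
Lemma value_stable k k' l : (weight l < k)%N -> (weight l < k')%N ->
  value k xletter l = value k' xletter l.
Proof.
elim/ltn_ind: k k' l => -[|k] IH [|k'] l //.
rewrite !ltnS !valueS eqxx => lk lk'.
case E: (elim_index l) => [[j l']|] //; have [Jj lE] := elim_indexP E.
have wl' := weight_top (n j) l'; have wlow := weight_low (n j) l'.
rewrite -lE in wl' wlow.
have E1 : value k xletter l' = value k' xletter l' by apply: IH; lia.
have E2 z : z != xletter -> value k z =1 value k' z.
  by move=> zx p; rewrite !value_nonx.
rewrite (@ulocal _ _ _ _ _ E2 E1) (@xlocal_run_word _ _ _ _ _ E2 E1).
by rewrite (IH k _ k') //; lia.
Qed.

Lemma psi_top j l : J0 j -> psi xletter (top (n j) l) =
  solve (cinv_last l) (cross stable_part psi (u j) l)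
    (cross stable_part psi (run_word (10 * (n j).+1)) l)
    (psi xletter (low (n j) l)).
Proof.
move=> Jj; rewrite /psi valueS eqxx elim_index_top //.
have wl := weight_top (n j) l; have wlow := weight_low (n j) l.
have E1 : value (weight (top (n j) l)) xletter l = psi xletter l.
  by apply: value_stable.
have E2 z : z != xletter -> value (weight (top (n j) l)) z =1 psi z.
  by move=> zx p; rewrite /psi !value_nonx.
rewrite (@ulocal _ _ _ _ _ E2 E1) (@xlocal_run_word _ _ _ _ _ E2 E1).
congr (solve _ _ _ _); exact: value_stable.
Qed.

Lemma cross_relator1 j l : J0 j ->
  cross stable_part psi (relator (u j) (n j)) l = 1.
Proof.
move=> Jj; rewrite cross_relator //.
have := psi_top l Jj; rewrite /top /low.
by case: (cinv_last l) => ->; [exact: (solveK true) | exact: (solveK false)].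
Qed.

Definition sigma : {multiplicative L -> G} :=
  fg_lift (fun b => f (gen (sletter b))).
Definition chi : {multiplicative H -> G} :=
  fg_lift (fun p => sigma p.2 * f (gen p.1) / sigma (p.2 * stable_part p.1)).

Lemma chi_free_value z l :
  chi (free_value z l) = sigma l * f (gen z) / sigma (l * stable_part z).
Proof.
case: z => [q|[b|o]]; rewrite ?[LHS]fg_lift_gen //=.
by rewrite [LHS]mult1 gmulfM /= [X in _ / (_ * X)]fg_lift_gen mulgV.
Qed.

Lemma sigma_stable w : eval_word (f \o gen) (stable_word w) = sigma (of_word w).
Proof.
rewrite [RHS]fg_lift_of_word; by elim: w => //= x w ->.
Qed.

Lemma eval_relator1 j : J0 j -> eval_word (f \o gen) (relator (u j) (n j)) = 1.
Proof.
move=> Jj; suff : (f @^-1` [set 1]) (of_word (relator (u j) (n j))).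
  by rewrite /preimage /= hom_eval -/(fg_lift _ _) fg_lift_of_word.
by rewrite kerf; apply: sub_gen_smallest; exists j.
Qed.

Lemma eval_elim_word_sigma m :
  eval_word (f \o gen) (elim_word m) =
    f (gen xletter) ^ (sigma (of_word (code_word m true)))^-1
    * f (gen xletter) ^ (sigma (of_word (code_word m false)))^-1.
Proof.
rewrite /elim_word [LHS]eval_word_cat.
have conjE w : eval_word (f \o gen) (conj_word w) =
    f (gen xletter) ^ (sigma (of_word w))^-1.
  rewrite eval_word_cat /= !sigma_stable of_word_inv multV conjgE invgK.
  by [].
by rewrite !conjE.
Qed.

(** True for any fuel: the relators hold in [G], so solving one of them, or stopping at a free
    generator, leaves the image in [G] unchanged. *)
Lemma chi_value k z l :
  chi (value k z l) = sigma l * f (gen z) / sigma (l * stable_part z).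
Proof.
elim: k z l => [|k IHk] z l; first exact: chi_free_value.
rewrite valueS.
case: eqP => [zx|_]; last exact: chi_free_value.
case E: (elim_index l) => [[j l']|]; last exact: chi_free_value.
have [Jj ->] := elim_indexP E; rewrite {}zx {E}.
(* The counterpart of [solve] in [G], isolating either of the two conjugates of x. *)
have solveG (A p q B : G) : A * (p * q * B) = 1 ->
    A^-1 * B^-1 * q^-1 = p /\ p^-1 * A^-1 * B^-1 = q.
  by move=> /mulg1_eq ->; rewrite !mulgK -!mulgA mulKg mulgV mulg1.
have conjE (v : seq (T * bool)) : eval_word stable_part v = 1 ->
    chi (cross stable_part (value k) v l') =
    eval_word (f \o gen) v ^ (sigma l')^-1.
  by move=> v1; rewrite (hom_cross IHk) v1 mulg1 conjgE invgK mulgA.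
have := eval_relator1 Jj; rewrite /relator [X in X = 1]eval_word_cat.
rewrite [X in _ * X = 1]eval_word_cat eval_elim_word_sigma /solve /top /low.
have lowE b : chi (value k xletter (l' * of_word (code_word (n j) b))) =
    (f (gen xletter) ^ (sigma (of_word (code_word (n j) b)))^-1) ^ (sigma l')^-1.
  by rewrite IHk mulg1 -conjgM -invgM -gmulfM conjgE invgK mulgA.
have -> b : sigma (l' * of_word (code_word (n j) b)) * f (gen xletter) /
    sigma (l' * of_word (code_word (n j) b) * stable_part xletter) =
    (f (gen xletter) ^ (sigma (of_word (code_word (n j) b)))^-1) ^ (sigma l')^-1.
  by rewrite -IHk lowE.
move: (conjE _ (ustable j)) (conjE _ (eval_run_word (10 * (n j).+1))).
case: (cinv_last l') => cA cB; rewrite !gmulfM !multV cA cB lowE -?conjVg -!conjMg.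
  by rewrite conjVg => /solveG[-> _].
by rewrite conjVg => /solveG[_ ->].
Qed.

Lemma relator_left_orderable : left_orderable G.
Proof.
have [PL PLP] := freegroup_cone bool.
have [PH PHP] := freegroup_cone (T * L)%type.
apply: (cross_left_orderable (s := stable_part) (psi := psi) (chi := chi)
  (sigma := sigma) fsurj _ _ PLP PHP); last by move=> z l; exact: chi_value.
rewrite kerf; apply: smallest_sub; first exact: cross_kernel_normal.
move=> _ [j Jj <-]; split=> [|l]; first by rewrite fg_lift_of_word eval_relator.
by rewrite cross_of_word cross_relator1.
Qed.

End LeftOrder.
End Relators.

(** * Small cancellation *)

Section SmallCancellation.
Variable X : finType.
Let T := alphabet X.
Implicit Types (x y : T * bool) (p s u w : seq (T * bool)) (n e k i m : nat).

Definition ypos i : T * bool := (yletter X (inord i), false).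

Definition is_y (b : bool) x : bool :=
  if x is (inr (inr (Some _)), b') then b == b' else false.

Definition no_yy b x y : bool := ~~ (is_y b x && is_y b y).

(** Imposed outside the runs; it confines adjacent positive letters y to the runs. *)
Definition good x y : bool :=
  [&& no_cancel x y, no_yy true x y & no_yy false x y].

(** Cyclically, [u] is preceded by a letter y and followed by c^-1, the first letter of [elim_word];
    both junctions are tested. *)
Definition admissible u n : Prop := (size u <= n + 4)%N /\
  forall i, path good (ypos i) (rcons u (sletter X false, true)).

Lemma size_conj_word (w : seq (bool * bool)) :
  size (conj_word X w) = (2 * size w + 1)%N.
Proof.
by rewrite size_cat /= !size_map size_rev size_map mul2n -addnn addnS addn1.
Qed.

Lemma size_elim_word n : size (elim_word X n) = (4 * n + 6)%N.
Proof. by rewrite size_cat !size_conj_word /= size_nseq; lia. Qed.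

Lemma size_run_word e : size (run_word X e) = (30 * e)%N.
Proof. exact: size_mkseq. Qed.

Lemma stable_code_inv n b : stable_word X (inv_word (code_word n b)) =
  rcons (nseq n (sletter X true, true)) (sletter X false, ~~ b).
Proof.
rewrite /inv_word /code_word /= rev_cons map_nseq rev_nseq /stable_word.
by rewrite map_rcons map_nseq.
Qed.

Lemma elim_wordE n : elim_word X n =
  (sletter X false, true) :: nseq n (sletter X true, false)
  ++ (xletter X, false)
  :: rcons (nseq n (sletter X true, true)) (sletter X false, false)
  ++ (sletter X false, false) :: nseq n (sletter X true, false)
  ++ (xletter X, false)
  :: rcons (nseq n (sletter X true, true)) (sletter X false, true).
Proof.
rewrite /elim_word /conj_word !stable_code_inv /stable_word /= !map_nseq /=.
by rewrite -catA.
Qed.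

Lemma good_elim_word n :
  path good (sletter X false, true) (behead (elim_word X n)).
Proof.
rewrite elim_wordE /=; case: n => [|n] //=.
have good_seq b : path good (sletter X true, b) (nseq n (sletter X true, b)).
  by elim: n => //= n ->; case: b.
have last_seq y : last y (nseq n y) = y by elim: n {good_seq}.
rewrite -!cats1.
by do ?[rewrite cat_path | rewrite last_cat | rewrite good_seq |
  rewrite last_seq | progress simpl].
Qed.

Definition pre u n := u ++ elim_word X n.

Lemma good_pre u n i : admissible u n -> path good (ypos i) (pre u n).
Proof.
move=> [_ /(_ i)]; rewrite /pre (_ : elim_word X n =
  (sletter X false, true) :: behead (elim_word X n)); last by rewrite elim_wordE.
by rewrite -cat_rcons cat_path => ->; rewrite last_rcons good_elim_word.
Qed.

Lemma last_pre x u n : last x (pre u n) = (sletter X false, true).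
Proof.
by rewrite last_cat elim_wordE /= last_cat /= last_cat /= last_cat /= last_rcons.
Qed.

Lemma relatorE u n : relator u n = pre u n ++ run_word X (10 * n.+1).
Proof. exact: catA. Qed.

(** The part of [good] that survives inside the runs. It bans adjacent inverse letters y, hence
    adjacent positive ones in the inverse of a relator. *)
Definition almost_good x y : bool := no_cancel x y && no_yy true x y.

Lemma run_word_cons e : (0 < e)%N -> exists r, run_word X e = ypos 0 :: r.
Proof.
by case: e => // e _; rewrite /run_word /mkseq /= div0n; eexists; reflexivity.
Qed.

Lemma almost_good_run x e : is_y false x -> path almost_good x (run_word X e).
Proof.
rewrite /run_word /mkseq; elim: (iota _ _) x => //= k s IHs [[q|[b|[j|]]] []] //= _.
by rewrite IHs // /almost_good /no_cancel xpair_eqE andbF.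
Qed.

Lemma last_run_word x e :
  is_y false x -> exists i, last x (run_word X e) = ypos i.
Proof.
have ex y : is_y false y -> exists i, y = ypos i.
  case: y => [[q|[b|[j|]]] []] //= _; exists j.
  by rewrite /ypos inord_val.
move=> xy; apply: ex; rewrite /run_word /mkseq.
by elim: (iota _ _) x xy => //= k s IHs x _; apply: IHs.
Qed.

Lemma good_almost_good : subrel good almost_good.
Proof. by move=> y z /and3P[cyz tyz _]; apply/andP. Qed.

Lemma almost_good_relator u n :
  admissible u n -> cycle almost_good (relator u n).
Proof.
(* Rotated so that the runs come first, [pre u n] is entered from a letter y, as in [admissible]. *)
move=> adm; rewrite -(rot_cycle (size (pre u n))) relatorE rot_size_cat.
have y0 : is_y false (ypos 0) by [].
have [r rE] := @run_word_cons (10 * n.+1) isT.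
have [i] := last_run_word (10 * n.+1) y0.
have := almost_good_run (10 * n.+1) y0; rewrite rE /= => /andP[_ gr] lr.
rewrite rcons_cat cat_path gr lr /=.
rewrite rcons_path last_pre andbT.
by apply: (sub_path good_almost_good); exact: good_pre.
Qed.

Lemma cyclically_reduced_relator u n :
  admissible u n -> cycle (@no_cancel T) (relator u n).
Proof.
by move=> /almost_good_relator; apply: sub_cycle => x y /andP[].
Qed.

Lemma cycle_sorted (R : rel (T * bool)) w : cycle R w -> sorted R w.
Proof. by case: w => //= x w; rewrite rcons_path => /andP[]. Qed.

Lemma reduced_relator u n : admissible u n -> reduced (relator u n).
Proof. by move=> /cyclically_reduced_relator; exact: cycle_sorted. Qed.

Lemma size_relator u n : size (relator u n) = (size (pre u n) + 300 * n.+1)%N.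
Proof. by rewrite relatorE size_cat size_run_word mulnA. Qed.

Lemma nth_relator_run u n k : (k < 300 * n.+1)%N ->
  nth (ypos 0) (relator u n) (size (pre u n) + k) = ypos (k %/ (10 * n.+1)).
Proof.
move=> lk; rewrite relatorE nth_cat ltnNge leq_addr /= addKn nth_mkseq //; lia.
Qed.

Lemma ypos_inj i m : (i < 30)%N -> (m < 30)%N -> ypos i = ypos m -> i = m.
Proof.
by move=> li lm [] /(congr1 val); rewrite /= !inordK.
Qed.

(** No two letters y are adjacent in [pre u n] or across its ends, so distinct ones meet only
    between two runs; [i] is then the last position of run [m]. *)
Lemma relator_junction u n i m m' :
  admissible u n -> (i < size (relator u n))%N ->
  (m < 30)%N -> (m' < 30)%N -> m <> m' ->
  nth (ypos 0) (relator u n) i = ypos m ->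
  nth (ypos 0) (relator u n) (if (i.+1 < size (relator u n))%N then i.+1 else 0)
    = ypos m' ->
  i.+1 = (size (pre u n) + m.+1 * (10 * n.+1))%N.
Proof.
move=> adm; rewrite size_relator => li lm lm' mm'.
have /(pathP (ypos 0)) gd := good_pre 0 adm.
have [lti|lei] := ltnP i (size (pre u n)).
  rewrite ifT; last by lia.
  rewrite {1}relatorE nth_cat lti => Ei.
  have [lti1|lei1] := ltnP i.+1 (size (pre u n)).
    rewrite relatorE nth_cat lti1 => Ei1; have := gd _ lti1.
    by rewrite /= Ei Ei1 => /and3P[].
  have := last_pre (ypos 0) u n; rewrite -nth_last.
  by rewrite (_ : (size (pre u n)).-1 = i) ?Ei //; lia.
have [k ik] : exists k, i = (size (pre u n) + k)%N.
  by exists (i - size (pre u n))%N; lia.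
have ke : (k < 300 * n.+1)%N by lia.
rewrite {1}ik nth_relator_run // => /ypos_inj km.
have {}km : k %/ (10 * n.+1) = m by apply: km => //; rewrite ltn_divLR //; lia.
case: ifP => [lti1|_].
  rewrite ik -addnS nth_relator_run; last by lia.
  move=> /ypos_inj km'.
  have {}km' : k.+1 %/ (10 * n.+1) = m'.
    by apply: km' => //; rewrite ltn_divLR //; lia.
  (* The quotients of k and k + 1 differ only if k + 1 is a multiple of the run length. *)
  have := divn_eq k (10 * n.+1); have := divn_eq k.+1 (10 * n.+1).
  have := @ltn_pmod k (10 * n.+1) isT; have := @ltn_pmod k.+1 (10 * n.+1) isT.
  rewrite km km'; nia.
rewrite relatorE nth_cat.
have size_pre : (0 < size (pre u n))%N by rewrite size_cat size_elim_word; lia.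
by rewrite size_pre => E0; have := gd _ size_pre; rewrite /= E0 => /and3P[].
Qed.

(** For i < N and c <= N this is i + c modulo N, the place in a word of length N of letter i of its
    rotation by c. *)
Definition pos (c N i : nat) : nat :=
  if (i + c < N)%N then (i + c)%N else (i + c - N)%N.

Lemma nth_rot (x : T * bool) w c i : (c <= size w)%N -> (i < size w)%N ->
  nth x (rot c w) i = nth x w (pos c (size w) i).
Proof.
move=> lc li; rewrite /rot nth_cat size_drop /pos.
have -> : (i < size w - c)%N = (i + c < size w)%N by apply/idP/idP; lia.
case: ifP => lic; first by rewrite nth_drop addnC.
rewrite nth_take; last by lia.
by congr (nth _ _ _); lia.
Qed.

(** At most n + 4 letters of [u] and 4 n + 6 of [elim_word] make 5 n + 10, no more than one run. *)
Lemma size_pre_bounds u n : admissible u n ->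
  (0 < size (pre u n) <= 10 * n.+1)%N.
Proof. by move=> [su _]; rewrite size_cat size_elim_word; lia. Qed.

(* A window of one sixth of the relator contains a full run of some y_(m+1),
   with both neighbours. *)
Lemma window_junction u n c k : admissible u n -> (c < size (relator u n))%N ->
  (size (relator u n) <= 6 * k)%N ->
  exists m o, [/\ (m < 28)%N, (o + 10 * n.+1 + 1 < k)%N &
    (pos c (size (relator u n)) o).+1 = size (pre u n) + m.+1 * (10 * n.+1)]%N.
Proof.
move=> /size_pre_bounds; rewrite /pos size_relator.
have -> : (300 * n.+1 = 30 * (10 * n.+1))%N by lia.
move: (size (pre u n)) (10 * n.+1)%N => h e /andP[h0 he] lc lk.
have [lch|lch] := ltnP c (h + e).
  by exists 0, (h + e - 1 - c)%N; split=> //; [lia | case: ifP; lia].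
pose m := ((c - h) %/ e)%N.
have e0 : (0 < e)%N by lia.
have mE : (c - h = m * e + (c - h) %% e)%N := divn_eq _ _.
have me := ltn_pmod (c - h) e0; move: mE me; move: (_ %% e)%N => r mE me.
have [lm|lm] := ltnP m 28.
  by exists m, (m.+1 * e + h - 1 - c)%N; split=> //; [nia | case: ifP; nia].
(* A window starting in one of the last two runs wraps around to the end of run 0. As h <= e, the
   offset is at most 4 e - 1, and a sixth of h + 30 e exceeds 5 e: 30 runs leave just enough
   room. *)
exists 0, (30 * e + h - c + h + e - 1)%N; split=> //; first nia.
case: ifP; nia.
Qed.

Lemma run_index_bound q r n : (q < 30)%N -> (r < 10 * n.+1)%N ->
  (q * (10 * n.+1) + r < 300 * n.+1)%N.
Proof. by move=> lq lr; have := leq_mul lq (leqnn (10 * n.+1)); lia. Qed.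

(** The two ends of a full run in the window are ends of the same-numbered runs in the second
    relator. Their distance is the run length, which gives n1 = n2; their place then gives the
    rotation. *)
Lemma common_window u1 u2 n1 n2 c1 c2 k :
  admissible u1 n1 -> admissible u2 n2 ->
  (c1 < size (relator u1 n1))%N -> (c2 < size (relator u2 n2))%N ->
  (size (relator u1 n1) <= 6 * k)%N ->
  (k <= size (relator u1 n1))%N -> (k <= size (relator u2 n2))%N ->
  (forall i, (i < k)%N ->
     nth (ypos 0) (relator u1 n1) (pos c1 (size (relator u1 n1)) i) =
     nth (ypos 0) (relator u2 n2) (pos c2 (size (relator u2 n2)) i)) ->
  n1 = n2 /\ (u1 = u2 -> c1 = c2).
Proof.
move=> adm1 adm2 lc1 lc2 lk lk1 lk2 E.
have [m [o [lm lo junc]]] := window_junction adm1 lc1 lk.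
have /andP[h1 he1] := size_pre_bounds adm1.
have /andP[h2 he2] := size_pre_bounds adm2.
have nth1 i j : (j < 300 * n1.+1)%N -> (i < k)%N ->
    (pos c1 (size (relator u1 n1)) i = size (pre u1 n1) + j)%N ->
    nth (ypos 0) (relator u2 n2) (pos c2 (size (relator u2 n2)) i)
      = ypos (j %/ (10 * n1.+1)).
  by move=> lj li Ei; rewrite -E // Ei nth_relator_run.
have divE q r : (r < 10 * n1.+1)%N ->
    ((q * (10 * n1.+1) + r) %/ (10 * n1.+1) = q)%N.
  by move=> lr; rewrite divnMDl // divn_small // addn0.
have sz1 := size_relator u1 n1; have sz2 := size_relator u2 n2.
have posS c N i : (c < N)%N -> (i.+1 < N)%N ->
    pos c N i.+1 = if ((pos c N i).+1 < N)%N then (pos c N i).+1 else 0%N.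
  by rewrite /pos => *; do ?case: ifP; lia.
have junc2 q i : (q < 28.+1)%N -> (i.+1 < k)%N ->
    ((pos c1 (size (relator u1 n1)) i).+1 =
      size (pre u1 n1) + q.+1 * (10 * n1.+1))%N ->
    ((pos c2 (size (relator u2 n2)) i).+1 =
      size (pre u2 n2) + q.+1 * (10 * n2.+1))%N.
  move=> lq li Ei; apply: (@relator_junction _ _ _ q q.+1) => //; try lia.
  - by rewrite /pos; case: ifP; lia.
  - rewrite (nth1 i (q * (10 * n1.+1) + (10 * n1.+1 - 1))%N) ?divE //; try lia.
    by apply: run_index_bound; lia.
  - rewrite -posS; [|lia|lia].
    rewrite (nth1 i.+1 (q.+1 * (10 * n1.+1) + 0)%N) ?divE //; try lia.
      by apply: run_index_bound; lia.
    by rewrite posS; [rewrite ifT; have := @run_index_bound q.+1 0 n1; lia|lia|lia].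
have J0 := junc2 m o (leqW lm) ltac:(lia) junc.
have lm1 : (m.+1 < 29)%N by lia.
have := junc2 m.+1 (o + 10 * n1.+1)%N lm1 ltac:(lia).
have -> : (pos c1 (size (relator u1 n1)) (o + 10 * n1.+1) =
    pos c1 (size (relator u1 n1)) o + 10 * n1.+1)%N.
  by move: junc; rewrite /pos; do 2?case: ifP; nia.
move=> /(_ ltac:(nia)) J1.
have nE : n1 = n2.
  by move: J0 J1; rewrite /pos; do 2?case: ifP; nia.
split=> // uE; subst n2 u2.
by move: junc J0; rewrite /pos; do 2?case: ifP; lia.
Qed.

End SmallCancellation.

(** * Common prefixes of rotated relators and their inverses *)

Section Pieces.
Variable X : finType.
Let T := alphabet X.
Implicit Types (p s u w : seq (T * bool)) (n c : nat).

Lemma rot_lt w c :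
  (0 < size w)%N -> exists2 c', (c' < size w)%N & rot c w = rot c' w.
Proof.
move=> w0; have [lc|lc] := ltnP c (size w); first by exists c.
by exists 0 => //; rewrite rot0 rot_oversize.
Qed.

Lemma size_relator_gt u n : (300 <= size (relator (X := X) u n))%N.
Proof. by rewrite size_relator; lia. Qed.

Lemma nth_prefix p s c w i :
  p ++ s = rot c w -> (c < size w)%N -> (i < size p)%N ->
  nth (ypos X 0) p i = nth (ypos X 0) w (pos c (size w) i).
Proof.
move=> E lc li; have sE : size w = size (p ++ s) by rewrite E size_rot.
rewrite -nth_rot; [|exact: ltnW|rewrite sE size_cat; lia].
by rewrite -E nth_cat li.
Qed.

Lemma positive_piece u1 u2 n1 n2 c1 c2 p s1 s2 :
  admissible u1 n1 -> admissible u2 n2 ->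
  p ++ s1 = rot c1 (relator u1 n1) -> p ++ s2 = rot c2 (relator u2 n2) ->
  (size (relator u1 n1) <= 6 * size p)%N ->
  n1 = n2 /\ (u1 = u2 -> s1 = s2).
Proof.
move=> adm1 adm2.
have [|c1' lc1 ->] := @rot_lt (relator u1 n1) c1.
  exact: leq_trans (size_relator_gt _ _).
have [|c2' lc2 ->] := @rot_lt (relator u2 n2) c2.
  exact: leq_trans (size_relator_gt _ _).
move=> E1 E2 lp.
have S1 : size (relator u1 n1) = size (p ++ s1) by rewrite E1 size_rot.
have S2 : size (relator u2 n2) = size (p ++ s2) by rewrite E2 size_rot.
have [| |i li|nE cE] := common_window adm1 adm2 lc1 lc2 lp.
- by rewrite S1 size_cat leq_addr.
- by rewrite S2 size_cat leq_addr.
- by rewrite -(nth_prefix E1) // -(nth_prefix E2).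
split=> // uE; have cE' := cE uE; subst n2 u2 c2'.
by move: E2; rewrite -E1 => /eqP; rewrite eqseq_cat // eqxx => /eqP.
Qed.

(** Such a [p] contains two adjacent positive letters y, and the inverse of a relator has none. *)
Lemma negative_piece u1 u2 n1 n2 c1 c2 p s1 s2 :
  admissible u1 n1 -> admissible u2 n2 ->
  p ++ s1 = rot c1 (relator u1 n1) ->
  p ++ s2 = rot c2 (inv_word (relator u2 n2)) ->
  (size (relator u1 n1) <= 6 * size p)%N -> False.
Proof.
move=> adm1 adm2.
have [|c1' lc1 ->] := @rot_lt (relator u1 n1) c1.
  exact: leq_trans (size_relator_gt _ _).
move=> E1 E2 lp.
have [m [o [lm lo junc]]] := window_junction adm1 lc1 lp.
have : cycle (no_yy (X := X) false) (p ++ s2).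
  rewrite E2 rot_cycle rev_cycle cycle_map.
  apply: sub_cycle (almost_good_relator adm2) => x y /andP[_].
  rewrite /no_yy /= /is_y.
  by case: x y => [[q|[b|[i|]]] []] [[q'|[b'|[i'|]]] []].
case/(@cycle_sorted X)/cat_sorted2 => /(sortedP (ypos X 0)) sp _.
have lo' : (o.+1 < size p)%N by lia.
have := sp o lo'; rewrite (nth_prefix E1 lc1 lo') (nth_prefix E1 lc1 (ltnW lo')).
have := size_relator u1 n1 => sz.
have p0 : (pos c1' (size (relator u1 n1)) o =
    size (pre u1 n1) + (m.+1 * (10 * n1.+1)).-1)%N by lia.
have p1 : (pos c1' (size (relator u1 n1)) o.+1 =
    size (pre u1 n1) + (m.+1 * (10 * n1.+1)))%N.
  by have := @run_index_bound m.+1 0 n1; move: junc; rewrite /pos; case: ifP;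
    case: ifP; lia.
have b1 := @run_index_bound m.+1 0 n1.
by rewrite p0 p1 !nth_relator_run //; lia.
Qed.

Section Family.
Variables (J : Type) (J0 : set J) (n : J -> nat) (u : J -> seq (T * bool)).
Hypotheses (n_inj : injective n) (uadm : forall j, admissible (u j) (n j)).
Let R : set (freegroup T) := (fun j => of_word (relator (u j) (n j))) @` J0.

Lemma relator_rot (v : freegroup T) : symmetrized R v -> exists j c,
  word v = rot c (relator (u j) (n j)) \/
  word v = rot c (inv_word (relator (u j) (n j))).
Proof.
move=> [_ [_ [j _ <-] vE]]; exists j.
have wE := word_of_word (reduced_relator (uadm j)).
case: vE => -[c ->]; exists c; [left; by rewrite wE | right].
by congr (rot c _); exact: (congr1 (@inv_word T) wE).
Qed.

Lemma inv_word_rot c w : exists c', inv_word (rot c w) = rot c' (inv_word w).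
Proof.
exists (size (inv_word (drop c w))).
have -> : inv_word w = inv_word (drop c w) ++ inv_word (take c w).
  by rewrite -inv_word_cat cat_take_drop.
by rewrite rot_size_cat /rot inv_word_cat.
Qed.

(** If [v1] comes from an inverse relator, both words are inverted first. Then equal signs fall
    under [positive_piece], and opposite signs are excluded by [negative_piece]. *)
Lemma piece (v1 v2 : freegroup T) p s1 s2 :
  symmetrized R v1 -> symmetrized R v2 ->
  word v1 = p ++ s1 -> word v2 = p ++ s2 ->
  (size (word v1) <= 6 * size p)%N -> s1 = s2.
Proof.
move=> /relator_rot[j1 [c1 E1]] /relator_rot[j2 [c2 E2]].
have same c c' q t1 t2 : q ++ t1 = rot c (relator (u j1) (n j1)) ->
    q ++ t2 = rot c' (relator (u j2) (n j2)) ->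
    (size (relator (u j1) (n j1)) <= 6 * size q)%N -> t1 = t2.
  move=> e1 e2 lq.
  have := positive_piece (uadm j1) (uadm j2) e1 e2 lq.
  by move=> [/n_inj jE /(_ (congr1 u jE))].
(* Inversion moves p^-1 to the end; a rotation makes it a prefix again. *)
have flip c w t : inv_word (p ++ t) = rot c w ->
    exists c', inv_word p ++ inv_word t = rot c' w.
  move=> E; rewrite -(rot_size_cat (inv_word t)) -inv_word_cat E rot_rot_add.
  by eexists; reflexivity.
have invrot c w t : p ++ t = rot c (inv_word w) ->
    exists c', inv_word p ++ inv_word t = rot c' w.
  move=> E; have [c' E'] := inv_word_rot c (inv_word w).
  by apply: (flip c'); rewrite E E' inv_wordK.
have invrot' c w t : p ++ t = rot c w ->
    exists c', inv_word p ++ inv_word t = rot c' (inv_word w).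
  by move=> E; apply: (invrot c); rewrite inv_wordK.
move=> v1E v2E; rewrite v1E in E1; rewrite v2E in E2; rewrite {}v1E.
case: E1 => E1.
  rewrite E1 size_rot => lp; case: E2 => E2; first exact: (same c1 c2 p).
  by case: (negative_piece (uadm j1) (uadm j2) E1 E2 lp).
rewrite E1 size_rot size_rev size_map => lp.
have lp' : (size (relator (u j1) (n j1)) <= 6 * size (inv_word p))%N.
  by rewrite size_rev size_map.
have [c1' E1'] := invrot _ _ _ E1.
case: E2 => E2.
  have [c2' E2'] := invrot' _ _ _ E2.
  by case: (negative_piece (uadm j1) (uadm j2) E1' E2' lp').
have [c2' E2'] := invrot _ _ _ E2.
by apply: (can_inj (@inv_wordK T)); exact: (same c1' c2' (inv_word p)).
Qed.

Lemma relators_small_cancellation : small_cancellation_words R.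
Proof.
split=> [|_ [j _ <-]|v1 v2 sv1 sv2 v12]; first exact: countableP.
  rewrite /cyclically_reduced /wlen word_of_word; last exact: reduced_relator.
  split; first exact: cyclically_reduced_relator.
  exact: leq_trans (size_relator_gt _ _).
(* What cancels in v1^-1 v2 is a common prefix of [v1] and [v2], and its length is the Gromov
   product. *)
have [a [c [b [e1 e2 e12]]]] := mul_cancellation v1^-1 v2.
have {}e1 : word v1 = inv_word c ++ inv_word a.
  by rewrite -inv_word_cat -e1 inv_wordK.
have gE : gromov_product v1 v2 = ((size c)%:R)%R.
  rewrite /gromov_product /wlen e1 e2 e12 !size_cat !size_rev !size_map.
  rewrite !GRing.natrD.
  lra.
rewrite gE Order.TotalTheory.ltNge; apply/negP => le_c.
have {}le_c : (minn (wlen v1) (wlen v2) <= 6 * size (inv_word c))%N.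
  rewrite size_rev size_map -(Num.Theory.ler_nat rat) GRing.natrM.
  lra.
apply: v12; apply/val_inj; move: le_c; rewrite geq_min => /orP[] lc.
  (* [piece] measures the prefix against its first word, so the shorter word is put first. *)
  by rewrite /= e1 e2 (piece sv1 sv2 e1 e2 lc).
by rewrite /= e1 e2 (piece sv2 sv1 e2 e1 lc).
Qed.

End Family.
End Pieces.

(** * The extension *)

Section FiniteGeneration.

Lemma finitely_generated_sub (N G : groupType) (i : {multiplicative N -> G})
    (S : set G) :
  injective i -> finite_set S -> range i = generated S -> finitely_generated N.
Proof.
move=> inj_i finS iS; exists (i @^-1` S); split.
  by apply: finite_preimage => // x y _ _; exact: inj_i.
apply/seteqP; split=> // x _.
have : (i @` generated (i @^-1` S)) (i x).
  have : generated S (i x) by rewrite -iS; exists x.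
  apply: smallest_sub.
    exact: subgroup_image (generated_subgroup _).
  move=> s Ss; have : range i s by rewrite iS; exact: sub_gen_smallest.
  case=> y _ ys; exists y => //; apply: sub_gen_smallest.
  by rewrite /preimage /= ys.
by case=> y Sy /inj_i <-.
Qed.

Lemma finitely_generated_free (X : finType) (G : groupType)
    (f : {multiplicative freegroup X -> G}) :
  range f = setT -> finitely_generated G.
Proof.
move=> fsurj; exists (range (f \o gen)); split.
  exact/finite_image/finite_finset.
apply/seteqP; split=> // g _; have : range f g by rewrite fsurj.
case=> x _ <-; have : (f @^-1` generated (range (f \o gen))) x; last by [].
rewrite (subgroup_free (subgroup_preimage f (generated_subgroup _))) // => a.
by apply: sub_gen_smallest; exists a.
Qed.

Lemma finitely_generated_presentation (Q : groupType) : finitely_generated Q ->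
  exists (X : finType) (R : set (freegroup X)), presented_by R Q.
Proof.
case=> S [/finite_seqP[s ->] sQ].
pose f := fg_lift (fun i : 'I_(size s) => nth 1 s i).
(* All relations among the generators serve as relators. *)
exists 'I_(size s), (f @^-1` [set 1]), f; split; last first.
  by apply/esym/smallest_id; exact: normal_kernel.
apply/seteqP; split=> // q _; have : generated [set` s] q by rewrite sQ.
apply: smallest_sub.
  apply: (@subgroup_image _ _ (f : {multiplicative _ -> _})).
  by split.
move=> x /= xs; have ls : (index x s < size s)%N by rewrite index_mem.
by exists (gen (Ordinal ls)); rewrite // /f fg_lift_gen /= nth_index.
Qed.

End FiniteGeneration.

(** * The group G, its map to Q and the kernel N *)

Section Rips.
Variables (Q : groupType) (X : finType) (RQ : set (freegroup X)).
Variable fQ : {multiplicative freegroup X -> Q}.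
Hypothesis fQsurj : range fQ = setT.
Hypothesis (kerfQ : fQ @^-1` [set 1] = normal_closure RQ).
Let T := alphabet X.

(* [inl ((q, e), z)] makes the conjugate of z by q^e (e = true for q^-1) a word
   in the generators of N; [inr r] does the same for a relator r of Q. *)
Definition relator_index : countType :=
  ((X * bool) * (bool + option 'I_30) + freegroup X)%type.
Let J := relator_index.

Definition head_word (j : J) : seq (T * bool) :=
  match j with
  | inl ((q, e), z) =>
      [:: (inl q, e); (inr z, false); (inl q, ~~ e); (inr z, true)]
  | inr r => [seq (inl x.1, x.2) | x <- word r]
  end.

(** Summing positive terms over all codes up to that of [j] gives a function strictly increasing in
    the code, hence injective, that also bounds the size of the head. *)
Definition relator_rank (j : J) : nat := \sum_(i < (pickle j).+1)
  (if @unpickle J i is Some j' then size (head_word j') else 0).+1.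

Lemma relator_rank_size j : (size (head_word j) <= relator_rank j)%N.
Proof. by rewrite /relator_rank big_ord_recr /= pickleK; lia. Qed.

Lemma relator_rank_inj : injective relator_rank.
Proof.
pose F (k : nat) := (\sum_(i < k.+1)
  (if @unpickle J i is Some j' then size (head_word j') else 0).+1)%N.
have F_lt : {homo F : k l / (k < l)%N}.
  apply: homo_ltn => [? ? ?|k]; first exact: ltn_trans.
  by rewrite /F [ltnRHS]big_ord_recr /= addnS ltnS leq_addr.
move=> j j' E; apply: (pcan_inj pickleK).
have [lt|lt|//] := ltngtP (pickle j) (pickle j'); move: (F_lt _ _ lt);
  by rewrite /F -/(relator_rank j) -/(relator_rank j') E ltnn.
Qed.

Lemma head_admissible j : admissible (head_word j) (relator_rank j).
Proof.
split=> [|i]; first exact: leq_trans (relator_rank_size j) (leq_addr _ _).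
case: j => [[[q e] z]|r] /=.
  rewrite /good /no_cancel /no_yy /letter_inv /= !xpair_eqE /=.
  by case: z e => [[]|[?|]] [].
have emb x w : path (@no_cancel X) x w ->
    path (@good X) (inl x.1, x.2)
      (rcons [seq (inl y.1, y.2) | y <- w] (sletter X false, true)).
  elim: w x => [|y w IHw] [q e] //= /andP[xy /IHw ->].
  by move: xy; rewrite /good /no_cancel /no_yy /letter_inv /= !xpair_eqE /= => ->.
by case: r => [[|[q e] w] rw] //=; apply: (emb (q, e)).
Qed.

Lemma head_stable j : eval_word (@stable_part X) (head_word j) = 1.
Proof.
case: j => [[[q e] z]|r] /=; last first.
  by apply: eval_nonstable; apply/allP => _ /mapP[x _ ->].
by case: e; rewrite /eval_letter /= ?invg1 !mul1g mulg1 mulgV.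
Qed.

(** In a commutator, z^-1 runs back along the edge of z, so both have the weight of z at [l], as the
    letters of X do not move in [L]. Relators of [Q] contain no x. *)
Lemma head_xlocal j : xlocal (head_word j).
Proof.
move=> H psi psi' l E Ex; case: j => [[[q e] z]|r] /=; last first.
  elim: (word r) l Ex => //= -[q e] w IHw l Ex; rewrite IHw; last first.
    by case: e; rewrite /eval_letter /= ?invg1 mulg1.
  by congr (_ * _); case: e; rewrite /cross_letter /= E.
have Ez (p : freegroup bool) : p = l -> psi (inr z) p = psi' (inr z) p.
  move=> ->; case: (eqVneq (inr z : T) (xletter X)) => [->|zx] //; exact: E.
by case: e; rewrite /cross_letter /eval_letter /= !(E (inl q)) // ?invg1 !mulg1
  !mulgK !Ez.
Qed.

Definition rips_index : set J := [set j | if j is inr r then RQ r else True].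
Definition rips_relators : set (freegroup T) :=
  (fun j => of_word (relator (head_word j) (relator_rank j))) @` rips_index.

Lemma finite_rips_relators : finite_set RQ -> finite_set rips_relators.
Proof.
move=> finR; apply: finite_image.
apply: (@sub_finite_set _ _ (range inl `|` inr @` RQ)).
  by case=> [z|r] /= Rj; [left; exists z | right; exists r].
rewrite finite_setU; split; last exact: finite_image.
exact/finite_image/finite_finset.
Qed.

Definition to_Q : {multiplicative freegroup T -> Q} :=
  fg_lift (fun z : T => if z is inl q then fQ (gen q) else 1).
Definition retract : {multiplicative freegroup T -> freegroup X} :=
  fg_lift (fun z : T => if z is inl q then gen q else 1).
Definition embed : {multiplicative freegroup X -> freegroup T} :=
  fg_lift (fun q : X => gen (inl q : T)).

Lemma to_Q_retract g : to_Q g = fQ (retract g).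
Proof.
apply: (hom_ext (f := to_Q) (h := fQ \o retract)) => -[q|z] /=.
  by rewrite !fg_lift_gen.
by rewrite !fg_lift_gen [RHS]mult1.
Qed.

Lemma to_Q_embed r : to_Q (embed r) = fQ r.
Proof.
by apply: (hom_ext (f := to_Q \o embed) (h := fQ)) => q; rewrite /= !fg_lift_gen.
Qed.

Lemma embed_word r : embed r = of_word (head_word (inr r)).
Proof.
rewrite (_ : embed r = eval_word (fun q : X => gen (inl q : T)) (word r)) //.
rewrite /head_word; elim: (word r) => [|[q e] w IHw] /=; first exact/val_inj.
rewrite IHw -cat1s of_word_cat; congr (_ * _).
by case: e; exact/val_inj.
Qed.

Section Quotient.
Variables (G : groupType) (f : {multiplicative freegroup T -> G}).
Hypothesis fsurj : range f = setT.
Hypothesis (kerf : f @^-1` [set 1] = normal_closure rips_relators).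

Let M : set G := range (fun z : bool + option 'I_30 => f (gen (inr z : T))).
Let HM := generated M.
Let sHM : is_subgroup HM := generated_subgroup M.

Lemma normal_part_letter z : HM (f (gen (inr z : T))).
Proof. by apply: sub_gen_smallest; exists z. Qed.

Lemma normal_part_word (w : seq (T * bool)) :
  all (fun x => if x.1 is inr _ then true else false) w ->
  HM (eval_word (f \o gen) w).
Proof.
elim: w => [_|[[q|z] e] w IHw] //=; first exact: sHM.1.
move=> /IHw Hw; apply: (subgroupM sHM) => //.
case: e; rewrite /eval_letter /=; [apply: (subgroupV sHM) |];
  exact: normal_part_letter.
Qed.

Lemma nonq_tail k :
  all (fun x : T * bool => if x.1 is inr _ then true else false)
  (elim_word X k ++ run_word X (10 * k.+1)).
Proof.
rewrite all_cat; apply/andP; split.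
  rewrite elim_wordE.
  by do ?[rewrite all_cat | rewrite all_rcons | rewrite all_nseq |
    rewrite orbT | progress simpl].
by apply/allP => x /mapP[m _ ->].
Qed.

(** In [G] the head is the inverse of the rest of the relator, a word in the generators of [HM]. *)
Lemma head_word_normal_part j :
  rips_index j -> HM (eval_word (f \o gen) (head_word j)).
Proof.
move=> Rj.
have : eval_word (f \o gen) (relator (head_word j) (relator_rank j)) = 1.
  suff : (f @^-1` [set 1]) (of_word (relator (head_word j) (relator_rank j))).
    by rewrite /preimage /= hom_eval -/(fg_lift _ _) fg_lift_of_word.
  by rewrite kerf; apply: sub_gen_smallest; exists j.
rewrite [X in X = 1]eval_word_cat => /eqP; rewrite mulg_eq1 => /eqP ->.
exact: (subgroupV sHM (normal_part_word (nonq_tail _))).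
Qed.

(** For q in X, the conjugate of z by q^e is [q^e, z] z, and the commutator is a head. Both signs e
    occur among the relators. *)
Lemma normal_part_conj_letter (x : T * bool) h : HM h ->
  HM (eval_letter (f \o gen) x * h / eval_letter (f \o gen) x).
Proof.
case: x => [[q|z] e]; last first.
  move=> Hh; have := @normal_part_word [:: (inr z, e)] isT; rewrite /= mulg1 => Hg.
  exact: sHM.2 (subgroupM sHM Hg Hh) Hg.
pose g := eval_letter (f \o gen) (inl q : T, e); rewrite -/g.
have conjE h' : g * h' / g = h' ^ g^-1 by rewrite conjgE invgK mulgA.
rewrite conjE.
apply: (@smallest_sub _ _ _ [set h | HM (h ^ g^-1)]).
  split; first by rewrite /= conj1g; exact: sHM.1.
  by move=> a b Ha Hb /=; rewrite conjMg conjVg; exact: sHM.2.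
move=> _ [z _ <-] /=; have := head_word_normal_part (j := inl ((q, e), z)) I.
have -> : eval_word (f \o gen) (head_word (inl (q, e, z))) =
    f (gen (inr z : T)) ^ g^-1 / f (gen (inr z : T)).
  rewrite /= (_ : (inl q : T, ~~ e) = letter_inv (inl q : T, e)) //.
  rewrite eval_letter_inv -/g.
  by rewrite /eval_letter /= mulg1 conjgE invgK !mulgA.
move=> Hz; rewrite -[X in HM X](mulgVK (f (gen (inr z : T)))).
exact: (subgroupM sHM Hz (normal_part_letter z)).
Qed.

Lemma normal_part_normal : is_normal_subgroup HM.
Proof.
split=> // h g Hh; have : range f g^-1 by rewrite fsurj.
case=> x _ xg; rewrite conjgE -{2}(invgK g) -xg mulgA hom_eval.
elim: (word x) => [|y w IHw] /=; first by rewrite invg1 mulg1 mul1g.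
by have := normal_part_conj_letter y IHw; rewrite invgM !mulgA.
Qed.

Lemma kernel_normal_part g : to_Q g = 1 -> HM (f g).
Proof.
have [K [pi [pisurj kerpi]]] := quotient_exists normal_part_normal.
have kerpiE x : (pi x = 1) <-> HM x by rewrite -kerpi.
have piE : pi (f g) = pi (f (embed (retract g))).
  apply: (hom_ext (f := pi \o f) (h := pi \o f \o embed \o retract)) => -[q|z] /=.
    by rewrite !fg_lift_gen.
  rewrite !fg_lift_gen [RHS](mult1 (pi \o f \o embed)).
  by apply/kerpiE; exact: (normal_part_letter z).
have embed1 r : fQ r = 1 -> pi (f (embed r)) = 1.
  move=> r1; have : (fQ @^-1` [set 1]) r by [].
  rewrite kerfQ; apply: (@smallest_sub _ _ _ ((pi \o f \o embed) @^-1` [set 1])).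
    exact: normal_kernel.
  move=> s Rs; apply/kerpiE; rewrite /= embed_word hom_eval.
  rewrite -/(fg_lift _ _) fg_lift_of_word.
  exact: (@head_word_normal_part (inr s)).
by rewrite to_Q_retract -kerpiE piE; exact: embed1.
Qed.

Lemma to_Q_nonq (w : seq (T * bool)) :
  all (fun x => if x.1 is inr _ then true else false) w ->
  eval_word (fun z : T => if z is inl q then fQ (gen q) else 1) w = 1.
Proof.
elim: w => //= -[[q|z] e] w IHw //= /IHw ->.
by case: e; rewrite /eval_letter /= ?invg1 mulg1.
Qed.

Lemma rips_relators_to_Q : normal_closure rips_relators `<=` to_Q @^-1` [set 1].
Proof.
apply: smallest_sub; first exact: normal_kernel.
move=> _ [j Rj <-]; rewrite /preimage /= fg_lift_of_word eval_word_cat.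
rewrite [X in _ * X]to_Q_nonq ?mulg1 ?nonq_tail //.
case: j Rj => [[[q e] z] _|r Rr] /=.
  by case: e; rewrite /eval_letter /= ?invg1 !mul1g ?mulg1 ?mulVg ?mulgV.
rewrite -[LHS](fg_lift_of_word) -(embed_word r) -[LHS]/(to_Q (embed r)) to_Q_embed.
have : normal_closure RQ r by exact: sub_gen_smallest.
by rewrite -kerfQ.
Qed.

End Quotient.

Lemma rips_left_orderable (G : groupType)
    (f : {multiplicative freegroup T -> G}) :
  range f = setT -> f @^-1` [set 1] = normal_closure rips_relators ->
  left_orderable G.
Proof.
exact: relator_left_orderable relator_rank_inj head_xlocal head_stable _ f.
Qed.

Lemma rips_extension : exists (N G : groupType)
    (i : {multiplicative N -> G}) (p : {multiplicative G -> Q}),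
  [/\ short_exact i p,
      [/\ left_orderable G, finitely_generated G & small_cancellation_group G],
      finitely_generated N
    & finite_set RQ -> finitely_presented G].
Proof.
have [G [f [fsurj kerf]]] := quotient_exists (normal_closure_normal rips_relators).
have [|p pf] := @factor_exists _ _ _ f to_Q fsurj.
  by rewrite kerf; exact: rips_relators_to_Q.
pose M : set G := range (fun z : bool + option 'I_30 => f (gen (inr z : T))).
have kerp : p @^-1` [set 1] = generated M.
  apply/seteqP; split=> [g|].
    have : range f g by rewrite fsurj.
    case=> x _ <-; rewrite /preimage /= pf; exact: kernel_normal_part.
  apply: smallest_sub; first by case: (normal_kernel p).
  by move=> _ [z _ <-]; rewrite /preimage /= pf [LHS]fg_lift_gen.
have [N [i [inj_i rangei]]] := subgroup_exists (generated_subgroup M).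
exists N, G, i, p; split.
- split=> //; first by rewrite kerp.
  apply/seteqP; split=> // q _; have : range fQ q by rewrite fQsurj.
  by case=> r _ <-; exists (f (embed r)); rewrite // pf to_Q_embed.
- split; first exact: rips_left_orderable fsurj kerf.
    exact: finitely_generated_free fsurj.
  exists T, rips_relators; split; last by exists f.
  exact: relators_small_cancellation relator_rank_inj head_admissible.
- apply: finitely_generated_sub inj_i _ rangei.
  exact/finite_image/finite_finset.
- move=> finR; exists T, rips_relators.
  by split; [exact: finite_rips_relators | exists f].
Qed.

End Rips.

Theorem theorem1p1 (Q : groupType) (hQ : finitely_generated Q) :
  exists (N G : groupType)
    (i : {multiplicative N -> G}) (p : {multiplicative G -> Q}),
    [/\ short_exact i p,
        [/\ left_orderable G, finitely_generated G
          & small_cancellation_group G],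
        finitely_generated N
      & finitely_presented Q -> finitely_presented G].
Proof.
(* A single [G] must serve both claims, so a finite presentation of [Q] is used whenever one
   exists. *)
have [[X [R [finR [f [fsurj kerf]]]]]|nfp] := pselect (finitely_presented Q).
  have [N [G [i [p [ex GP fgN GF]]]]] := rips_extension fsurj kerf.
  by exists N, G, i, p; split=> // _; exact: GF.
have [X [R [f [fsurj kerf]]]] := finitely_generated_presentation hQ.
have [N [G [i [p [ex GP fgN _]]]]] := rips_extension fsurj kerf.
by exists N, G, i, p; split.
Qed.
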